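(* Let $n$ be a positive integer and let $q$ be an odd positive integer. Let $A_n(q)=(\mathbb{Z}/(q))^n$, let $\Sigma_n$ be the symmetric group on $n$ letters acting on $A_n(q)$ by $\zeta\cdot(x_1,\ldots,x_n)=(x_{\zeta^{-1}(1)},\ldots,x_{\zeta^{-1}(n)})$, and let $B_n(q)=A_n(q)\cdot\Sigma_n$ be the corresponding semidirect product (with $A_n(q)$ normal). With the notation $P_n$, $P_{\leq q;n}$, $t$, $\Sigma_\lambda$, $D_\lambda$, $\chi_{b,\lambda}$, $\hat\gamma_{\mu_1,\mu_2,\ldots}$ defined in the context, the following hold for finite-dimensional complex representations. (i) The representations $$\mathrm{Ind}_{D_\lambda}^{B_n(q)}\left(\chi_{b,\lambda}\otimes\hat{\gamma}_{\mu_1,\mu_2,\ldots}\right),$$ where $\lambda=(\lambda_1,\lambda_2,\ldots)$ ranges over $P_{\leq q;n}$, $\overline{b}$ ranges over $t^{-1}(\lambda)$, and $\mu_i$ ranges over the partitions of $\lambda_i$ for each $i=1,2,\ldots$, are irreducible and pairwise non-isomorphic (for distinct data $(\lambda,\overline{b},\mu_1,\mu_2,\ldots)$), and each irreducible representation of $B_n(q)$ is isomorphic to one of this form. (ii) The group $B_n(q)$ has exactly $$\sum_{\lambda\in P_n}p(\lambda_1)\,p(\lambda_2)\cdots\, m_\lambda(\underbrace{1,\ldots,1}_{q\text{ times}},0,\ldots)$$ irreducible representations (up to isomorphism), where $p(k)$ is the number of partitions of $k$ (with $p(0)=1$) and $m_\lambda(x_1,x_2,\ldots)$ is the monomial symmetric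 function corresponding to $\lambda$.
   Context: $P_n$ denotes the set of all partitions of $n$, and $P_{\leq q;n}\subset P_n$ the set of those with at most $q$ nonzero parts. The dual $\mathbb{Z}/(q)$-module $A_n(q)^*$ consists of linear forms $b=b_1x_1+\cdots+b_nx_n$, identified with $b=(b_1,\ldots,b_n)\in(\mathbb{Z}/(q))^n$, with $b(x)=b_1x_1+\cdots+b_nx_n$. The contragredient action of $\Sigma_n$ is $\zeta\cdot b=(b_{\zeta^{-1}(1)},\ldots,b_{\zeta^{-1}(n)})$. The $\Sigma_n$-orbit of $b$ is denoted $\overline b$. For $b\in A_n(q)^*$ and $k\in\mathbb{Z}/(q)$ put $\ell_k^{(b)}=|\{i\in\{1,\ldots,n\}: b_i=k\}|$. Ordering the numbers $\ell_k^{(b)}$, $k\in\mathbb{Z}/(q)$, from largest to smallest gives a partition $\lambda^{(b)}\in P_n$. The map $b\mapsto\lambda^{(b)}$ is constant on $\Sigma_n$-orbits and so induces a map $t\colon\Sigma_n\backslash A_n(q)^*\to P_n$, $\overline b\mapsto\lambda^{(b)}$, whose image is $P_{\leq q;n}$. Fix a primitive $q$th root of unity $\varepsilon\in\mathbb{C}^*$. For $b\in A_n(q)^*$ let $\chi_b\colon A_n(q)\to\mathbb{C}^*$, $\chi_b(x)=\varepsilon^{b(x)}$; the map $b\mapsto\chi_b$ is an isomorphism from $A_n(q)^*$ onto the group of characters $\mathrm{Hom}(A_n(q),\mathbb{C}^* )$, and $\Sigma_n$ acts on the characters by $\zeta\cdot\chi_b=\chi_{\zeta\cdot b}$. For $\lambda=(\lambda_1,\lambda_2,\ldots)\in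 P_{\leq q;n}$ let $\Sigma_\lambda=\Sigma_{\lambda_1}\times\Sigma_{\lambda_2}\times\cdots\subset\Sigma_n$ be the Young subgroup, and let $D_\lambda=A_n(q)\cdot\Sigma_\lambda\subset B_n(q)$. In each orbit $\overline b\in t^{-1}(\lambda)$ choose (once and for all) a representative $b$ whose stabilizer in $\Sigma_n$ is exactly $\Sigma_\lambda$, and write $\chi_{b,\lambda}$ for the character $\chi_b$ of $A_n(q)$. Since $\chi_{b,\lambda}$ is stabilized by $\Sigma_\lambda$, it extends to a one-dimensional character of $D_\lambda$, denoted by the same letter, by $\chi_{b,\lambda}(x\zeta)=\chi_b(x)$ for $x\in A_n(q)$, $\zeta\in\Sigma_\lambda$. For a partition $\mu_i$ of $\lambda_i$ let $[\mu_i]$ be the corresponding irreducible complex representation of $\Sigma_{\lambda_i}$. Put $\gamma_{\mu_1,\mu_2,\ldots}=[\mu_1]\otimes[\mu_2]\otimes\cdots$, an irreducible representation of $\Sigma_\lambda$, and let $\hat\gamma_{\mu_1,\mu_2,\ldots}$ be its composition with the canonical projection $D_\lambda\to\Sigma_\lambda$. *)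

(* Defs.v *)
From HB Require Import structures.
From mathcomp Require Import all_boot all_order all_algebra all_fingroup.
From mathcomp Require Import all_solvable all_character.
From mathcomp Require Import reals complex mpoly.

Set Implicit Arguments.
Unset Strict Implicit.
Unset Printing Implicit Defensive.

Import GroupScope GRing.Theory.
Local Open Scope ring_scope.

(* (s * t)%g means first s, then t, the opposite of composition of functions, and
   an mx_representation acts on row vectors, v |-> v *m rG g, i.e. on the right.
   The two reversals cancel: below, row vectors carry left modules of the groups
   whose product is composition. *)

Section IntegerPartitions.

Definition is_part (n : nat) (s : seq nat) : bool :=
  [&& sorted geq s, 0%N \notin s & sumn s == n].

Record intpart (n : nat) := IntPart {
  parts :> seq nat;
  _ : is_part n parts }.

HB.instance Definition _ n := [isSub for @parts n].
HB.instance Definition _ n := [Choice of intpart n by <:].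

Variable n : nat.

Lemma partsP (lam : intpart n) : is_part n lam.
Proof. exact: valP lam. Qed.

Lemma sumn_parts (lam : intpart n) : sumn lam = n.
Proof. by case/and3P: (partsP lam) => _ _ /eqP. Qed.

Lemma mem_leq_sumn (s : seq nat) k : k \in s -> (k <= sumn s)%N.
Proof.
elim: s => //= a s IHs; rewrite inE => /predU1P[-> | /IHs le_ks].
  exact: leq_addr.
exact: leq_trans le_ks (leq_addl _ _).
Qed.

Lemma size_leq_sumn (s : seq nat) : 0%N \notin s -> (size s <= sumn s)%N.
Proof.
elim: s => //= a s IHs; rewrite inE negb_or eq_sym -lt0n => /andP[a_gt0 /IHs].
by rewrite -add1n; apply: leq_add.
Qed.

Definition intpart_code (lam : intpart n) : n.-bseq 'I_n.+1 :=
  insub_bseq n [seq inord k | k <- lam].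

Definition intpart_decode (s : n.-bseq 'I_n.+1) : option (intpart n) :=
  insub [seq val k | k <- s].

Lemma intpart_codeK : pcancel intpart_code intpart_decode.
Proof.
move=> lam; case/and3P: (partsP lam) => _ lam0 /eqP def_n.
rewrite /intpart_decode /intpart_code /insub_bseq insubdK; last first.
  by rewrite unfold_in size_map -[X in (_ <= X)%N]def_n size_leq_sumn.
rewrite -map_comp map_id_in ?valK // => k lam_k /=.
by rewrite inordK // ltnS -[X in (_ <= X)%N]def_n mem_leq_sumn.
Qed.

HB.instance Definition _ : isCountable (intpart n) :=
  PCanIsCountable intpart_codeK.
HB.instance Definition _ : isFinite (intpart n) := PCanIsFinite intpart_codeK.

End IntegerPartitions.

Definition npart (k : nat) : nat := #|{: intpart k}|.

(* m_lambda in N variables: the sum of the distinct monomials whose nonzero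
   exponents are, up to order, the parts of lambda. *)
Definition mon_sym (N : nat) (lam : seq nat) : {mpoly int[N]} :=
  \sum_(a : 'X_{1..N < (sumn lam).+1}
         | perm_eq [seq k <- codom (fun i : 'I_N => a i) | k != 0%N] lam)
    'X_[a].

Section LinearCharacter.

Variables (F : fieldType) (gT : finGroupType) (G : {group gT}) (chi : gT -> F).
Hypotheses (chi1 : chi 1%g = 1)
           (chiM : {in G &, {morph chi : x y / (x * y)%g >-> x * y}}).

Fact lin_mx_repr : mx_repr G (fun g => (chi g)%:M : 'M_1).
Proof. by split=> [|x y Gx Gy]; rewrite ?chi1 ?chiM ?scalar_mxM. Qed.

Definition lin_repr := MxRepresentation lin_mx_repr.

End LinearCharacter.

Section TensorProduct.

Variables (F : fieldType) (gT : finGroupType) (G : {group gT}).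

Fact triv_chiM : {in G &, {morph (fun=> 1 : F) : x y / (x * y)%g >-> x * y}}.
Proof. by move=> x y _ _; rewrite mulr1. Qed.

Definition triv_repr : mx_representation F G 1 := lin_repr (erefl _) triv_chiM.

Definition tens_repr (rs : seq (representation F G)) : representation F G :=
  foldr (fun r1 r2 : representation F G => Representation (prod_repr r1 r2))
        (Representation triv_repr) rs.

End TensorProduct.

(* Ind_H^G rho = rho (x)_{F[H]} F[G], in the basis e_j (x) t_i where the t_i
   represent the cosets H :* x in G. *)
Section InducedRepresentation.

Variables (F : fieldType) (gT : finGroupType) (H G : {group gT}).
Hypothesis sHG : H \subset G.
Variables (d : nat) (rho : mx_representation F H d).

Definition coset_rep (i : 'I_#|rcosets H G|) : gT := repr (enum_val i).

Definition ext0_mx (x : gT) : 'M[F]_d := if x \in H then rho x else 0.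

Definition ind_mx (g : gT) :=
  \mxblock_(i < #|rcosets H G|, k < #|rcosets H G|)
    ext0_mx (coset_rep i * g * (coset_rep k)^-1)%g.

Lemma rcoset_coset_rep i : H :* coset_rep i = enum_val i.
Proof.
have /rcosetsP[x _ def_i] := enum_valP i.
by rewrite /coset_rep def_i rcoset_repr.
Qed.

Lemma coset_repG i : coset_rep i \in G.
Proof.
have /rcosetsP[x Gx def_i] := enum_valP i.
rewrite /coset_rep def_i; have /rcosetP[h Hh ->] := mem_repr_rcoset H x.
by apply: groupM; first exact: (subsetP sHG).
Qed.

Lemma mem_coset_rep x i :
  (x * (coset_rep i)^-1 \in H)%g = (enum_val i == H :* x).
Proof.
by rewrite -mem_rcoset -rcoset_coset_rep; apply/rcoset_eqP/eqP => ->.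
Qed.

Lemma coset_rep_exists x : x \in G -> exists i, enum_val i = H :* x
  :> {set gT} /\ i \in [set: 'I_#|rcosets H G|].
Proof.
move=> Gx; have cosx : H :* x \in rcosets H G by rewrite mem_rcosets mulSGid.
by exists (enum_rank_in cosx (H :* x)); rewrite enum_rankK_in ?inE.
Qed.

Fact ind_mx_repr : mx_repr G ind_mx.
Proof.
split=> [|x y Gx Gy].
  rewrite /ind_mx -[RHS]mxdiagZ /mxdiag; apply/eq_mxblockP => i k.
  rewrite mulg1 /ext0_mx mem_coset_rep rcoset_coset_rep (inj_eq enum_val_inj).
  rewrite eq_sym; case: eqVneq => [->|//].
  by rewrite mulgV repr_mx1 conform_mx_id.
rewrite /ind_mx mul_mxblock; apply/eq_mxblockP => i k.
have Gix: (coset_rep i * x \in G)%g by rewrite groupM ?coset_repG.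
have [j [def_j _]] := coset_rep_exists Gix.
have Hj : (coset_rep i * x * (coset_rep j)^-1 \in H)%g.
  by rewrite mem_coset_rep def_j.
rewrite (bigD1 j) //= big1 ?addr0 => [|l ne_lj]; last first.
  rewrite /ext0_mx mem_coset_rep -def_j (inj_eq enum_val_inj) (negPf ne_lj).
  by rewrite mul0mx.
rewrite /ext0_mx Hj.
have -> : (coset_rep i * (x * y) * (coset_rep k)^-1 =
  coset_rep i * x * (coset_rep j)^-1 * (coset_rep j * y * (coset_rep k)^-1))%g.
  by rewrite !mulgA mulgKV.
rewrite groupMl //; case: ifP => Hjk; last by rewrite mulmx0.
by rewrite repr_mxM.
Qed.

Definition ind_repr := MxRepresentation ind_mx_repr.

End InducedRepresentation.

Section YoungSubgroup.

Variable n : nat.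

Definition keep_label (f : nat -> nat) : {set 'S_n} :=
  [set s : 'S_n | [forall i : 'I_n, f (s i) == f i]].

Lemma keep_labelP (f : nat -> nat) (s : 'S_n) :
  reflect (forall i : 'I_n, f (s i) = f i) (s \in keep_label f).
Proof. by rewrite inE; apply: (iffP forallP) => fs i; apply/eqP. Qed.

Fact keep_label_group_set f : group_set (keep_label f).
Proof.
apply/group_setP; split=> [|s t /keep_labelP fs /keep_labelP ft].
  by apply/keep_labelP => i; rewrite perm1.
by apply/keep_labelP => i; rewrite permM ft.
Qed.

Canonical keep_label_group f := Group (keep_label_group_set f).

(* {0, ..., n - 1} is cut into consecutive intervals of lengths lam_1, lam_2,
   ...; reshape_index lam i is the number of the interval containing i, and
   reshape_offset lam i is the position of i inside that interval. *)
Definition young (lam : seq nat) : {group 'S_n} :=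
  [group of keep_label (reshape_index lam)].

(* For the row by row filling of the diagram of lam, this is the column group,
   and young lam is the row group. *)
Definition col_young (lam : seq nat) : {group 'S_n} :=
  [group of keep_label (reshape_offset lam)].

End YoungSubgroup.

(* The Specht module F[S_m] c_mu, with c_mu the Young symmetrizer
   \sum_(t column, s row) sgn(t) (t after s) of the row by row filling; [mu] is
   this module for a partition mu of m. *)
Section Specht.

Variables (F : fieldType) (m : nat) (mu : seq nat).

Definition young_symmetrizer : 'rV[F]_#|[set: 'S_m]%G| :=
  \sum_(s in young m mu) \sum_(t in col_young m mu)
    (-1) ^+ odd_perm t *: delta_mx 0 (gring_index [set: 'S_m]%G (s * t)%g).

Definition specht :=
  submod_repr
    (cyclic_mx_module (regular_repr F [set: 'S_m]%G) young_symmetrizer).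

End Specht.

Section OuterTensor.

Variables (F : fieldType) (n : nat) (lam : intpart n).

Local Notation part k := (nth 0%N lam k).

Fact block_pos_subproof k (j : 'I_(part k)) : (flatten_index lam k j < n)%N.
Proof. by rewrite -[X in (_ < X)%N](sumn_parts lam) flatten_indexP. Qed.

Definition block_pos k (j : 'I_(part k)) : 'I_n :=
  Ordinal (block_pos_subproof j).

(* The permutation that s in young lam induces on the k-th interval, moved to
   {0, ..., lam_k - 1} by translation. *)
Definition block_perm (k : nat) (s : 'S_n) : 'S_(part k) :=
  odflt 1%g [pick t : 'S_(part k) |
              [forall j, s (block_pos j) == block_pos (t j)]].

Lemma block_pos_inj k : injective (@block_pos k).
Proof.
by move=> i j /(congr1 val) /= /addnI /val_inj.
Qed.

Lemma block_permP k s (j : 'I_(part k)) :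
  s \in young n lam -> s (block_pos j) = block_pos (block_perm k s j).
Proof.
move=> /keep_labelP ys; rewrite /block_perm.
case: pickP => [t /forallP/(_ j)/eqP // | no_t].
have off_lt (i : 'I_(part k)) :
    (reshape_offset lam (s (block_pos i)) < part k)%N.
  have := @reshape_offsetP lam (s (block_pos i)).
  by rewrite ys flatten_indexKl ?sumn_parts //; apply.
pose f i := Ordinal (off_lt i).
have fE i : s (block_pos i) = block_pos (f i).
  apply: val_inj; rewrite /= -[LHS](reshape_indexK lam) ys.
  by rewrite flatten_indexKl.
have f_inj : injective f.
  by move=> i1 i2 eq_f; apply/block_pos_inj/(@perm_inj _ s); rewrite !fE eq_f.
have /negP[] := no_t (perm f_inj).
by apply/forallP => i; rewrite permE fE.
Qed.

Fact block_permM k :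
  {in young n lam &, {morph block_perm k : s t / (s * t)%g >-> (s * t)%g}}.
Proof.
move=> s t ys yt; apply/permP => j; apply: block_pos_inj.
by rewrite -block_permP ?groupM // !permM -!block_permP.
Qed.

Canonical block_perm_morphism k := Morphism (@block_permM k).

Fact young_sub_block_perm k :
  young n lam \subset block_perm k @*^-1 [set: 'S_(part k)].
Proof.
by apply/subsetP => s ys; apply/morphpreP; split; [exact: ys | rewrite in_setT]. Qed.

Definition gamma (mus : seq (seq nat)) : representation F (young n lam) :=
  tens_repr
    [seq Representation
           (subg_repr
              (morphpre_repr (block_perm_morphism k)
                             (specht F (part k) (nth [::] mus k)))
              (young_sub_block_perm k))
       | k <- iota 0 (size lam)].

End OuterTensor.

(* 'I_q.-1.+1 is Z/(q) for every q > 0; 'Z_q would be Z/(2) for q = 1. *)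
Notation Zmod q := 'I_q.-1.+1.

(* Both A_n(q) and its dual: a linear form is given by its coefficients. *)
Notation Aq n q := 'rV[Zmod q]_n.

Section WreathProduct.

Variables n q : nat.
Implicit Types (x b : Aq n q) (s t : 'S_n).

Definition perm_coord x s : Aq n q := \row_i x ord0 ((s^-1)%g i).

Fact perm_coord_is_action : is_action [set: 'S_n] perm_coord.
Proof.
apply: is_total_action => [x | x s t].
  by apply/rowP => i; rewrite mxE invg1 perm1.
by apply/rowP => i; rewrite !mxE invMg permM.
Qed.

Canonical perm_coord_action := Action perm_coord_is_action.

Fact perm_coord_is_groupAction :
  is_groupAction [set: Aq n q] perm_coord_action.
Proof.
move=> s _; rewrite inE; apply/andP; split; first by apply/subsetP => x; rewrite inE.
apply/morphicP => x y _ _; rewrite !actpermE /=.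
by apply/rowP => i; rewrite !mxE.
Qed.

Canonical perm_coord_groupAction := GroupAction perm_coord_is_groupAction.

(* u : Bq is the pair (u.1, u.2) standing for x zeta with zeta = u.1 in Sigma_n
   and x = u.2 in A_n(q). *)
Definition Bq : finGroupType := sdprod_by perm_coord_groupAction.

Definition Bq_perm (u : Bq) : 'S_n := u.1.

Fact Bq_permM : {in [set: Bq] &, {morph Bq_perm : u v / (u * v)%g}}.
Proof. by []. Qed.

Canonical Bq_perm_morphism := Morphism Bq_permM.

Definition Dq (lam : seq nat) : {group Bq} :=
  [group of Bq_perm @*^-1 (young n lam)].

Lemma DqE lam :
  Dq lam = (sdpair1 perm_coord_groupAction @* [set: Aq n q]
            * sdpair2 perm_coord_groupAction @* (young n lam))%g :> {set Bq}.
Proof.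
have nAS : sdpair2 perm_coord_groupAction @* (young n lam)
    \subset 'N(sdpair1 perm_coord_groupAction @* [set: Aq n q])%g.
  apply: subset_trans (im_sdpair_norm perm_coord_groupAction).
  by rewrite morphimS ?subsetT.
rewrite -(normC nAS); apply/setP => u.
apply/morphpreP/mulsgP => [[_ yu] | [s x /morphimP[t _ yt ->] /morphimP[y _ _ ->]] ->].
  exists (sdpair2 perm_coord_groupAction u.1) (sdpair1 perm_coord_groupAction u.2).
  - by apply: mem_morphim; [rewrite in_setT | exact: yu].
  - by apply: mem_morphim; rewrite in_setT.
  - exact: sdpairE.
split; first by rewrite inE.
rewrite /= /Bq_perm /= !val_insubd !inE /= mulg1.
by apply/forallP => i; apply/eqP; move/keep_labelP: yt; apply.
Qed.

Definition pairing b x : Zmod q := \sum_i Zp_mul (b ord0 i) (x ord0 i).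

Definition mult b (k : Zmod q) : nat := #|[set i | b ord0 i == k]|.

Definition orbit_type_seq b : seq nat :=
  sort geq [seq l <- [seq mult b k | k : Zmod q] | l != 0%N].

Fact orbit_type_subproof b : is_part n (orbit_type_seq b).
Proof.
apply/and3P; split.
- by apply: sort_sorted => i j; exact: leq_total.
- by rewrite mem_sort mem_filter.
rewrite /orbit_type_seq (perm_sumn (permEl (perm_sort _ _))).
rewrite sumnE big_filter big_mkcond big_map big_enum /=.
rewrite (eq_bigr (mult b)) => [|k _]; last by case: eqP.
rewrite -[X in _ == X](card_ord n) -sum1_card (partition_big (b ord0) xpredT) //=.
by apply/eqP/eq_bigr => k _; rewrite sum1dep_card.
Qed.

Definition lam_of b : intpart n := IntPart (orbit_type_subproof b).

Definition orbits : {set {set Aq n q}} :=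
  [set orbit perm_coord_action [set: 'S_n] b | b : Aq n q].

Definition orbit_type (O : {set Aq n q}) : intpart n := lam_of (repr O).

Lemma orbit_typeE b :
  orbit_type (orbit perm_coord_action [set: 'S_n] b) = lam_of b.
Proof.
set O := orbit _ _ b.
have /orbitP[s _ def_r] : repr O \in O by apply/mem_repr/orbit_refl.
rewrite /orbit_type -def_r; apply: val_inj; congr (sort _ (filter _ _)).
apply: eq_map => k; rewrite /mult -[RHS](card_preimset _ (@perm_inj _ s^-1%g)).
by apply: eq_card => i; rewrite !inE mxE.
Qed.

Definition part_le : {set intpart n} := [set lam : intpart n | size lam <= q]%N.

Definition orbit_fiber (lam : intpart n) : {set {set Aq n q}} :=
  [set O in orbits | orbit_type O == lam].

Record orbit_reps := OrbitReps {
  orep :> {set Aq n q} -> Aq n q;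
  orep_in : forall O, O \in orbits -> orep O \in O;
  orep_stab : forall O, O \in orbits ->
    'C[orep O | perm_coord_action]%act = young n (orbit_type O) }.

(* mu_i is listed for the nonzero parts lam_i only, a zero part having just the
   empty partition.  The conditions are booleans, so two labels are equal as soon
   as (lambda, orbit of b, (mu_1, mu_2, ...)) are. *)
Record label := Label {
  lab_lam : intpart n;
  lab_orbit : {set Aq n q};
  lab_mus : seq (seq nat);
  lab_lamP : lab_lam \in part_le;
  lab_orbitP : lab_orbit \in orbit_fiber lab_lam;
  lab_musP : all2 is_part lab_lam lab_mus }.

Section Representations.

Variables (F : fieldType) (eps : F) (eps_prim : q.-primitive_root eps).

Definition chi b (u : Bq) : F := eps ^+ val (pairing b u.2).

Fact chi1 b : chi b 1%g = 1.
Proof.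
rewrite /chi /pairing big1 // => i _; rewrite mxE.
by apply: val_inj; rewrite /= muln0 mod0n.
Qed.

Lemma pairingD b x y : pairing b (x + y) = pairing b x + pairing b y.
Proof.
rewrite /pairing -big_split /=; apply: eq_bigr => i _; rewrite mxE.
exact: Zp_mul_addr.
Qed.

Lemma chi_add b x y :
  eps ^+ val (pairing b (x + y)) =
  eps ^+ val (pairing b x) * eps ^+ val (pairing b y).
Proof.
have prim : (q.-1.+1).-primitive_root eps.
  by rewrite prednK // (prim_order_gt0 eps_prim).
by rewrite pairingD -exprD /= (prim_expr_mod prim).
Qed.

Variables (lam : intpart n) (b : Aq n q).
Hypothesis stab_b : 'C[b | perm_coord_action]%act = young n lam.

Fact chiM : {in Dq lam &, {morph chi b : u v / (u * v)%g >-> u * v}}.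
Proof.
move=> u v _; rewrite !inE /= => yv.
have {yv} : v.1 \in 'C[b | perm_coord_action]%act by rewrite stab_b inE.
move=> /astab1P fix_b; rewrite /chi /= chi_add; congr (eps ^+ val _ * _).
rewrite /pairing (reindex_inj (@perm_inj _ v.1)) /=.
apply: eq_bigr => i _; rewrite -{1}fix_b !mxE permK.
by [].
Qed.

Definition chi_repr : mx_representation F (Dq lam) 1 :=
  lin_repr (chi1 b) chiM.

Definition gamma_hat (mus : seq (seq nat)) :=
  morphpre_repr Bq_perm_morphism (gamma F lam mus).

Definition ind_chi_gamma (mus : seq (seq nat)) :=
  ind_repr (subsetT (Dq lam)) (prod_repr chi_repr (gamma_hat mus)).

End Representations.

Lemma lab_stab (r : orbit_reps) (x : label) :
  'C[r (lab_orbit x) | perm_coord_action]%act = young n (lab_lam x).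
Proof.
have := lab_orbitP x; rewrite inE => /andP[orbO /eqP <-].
exact: orep_stab.
Qed.

End WreathProduct.

Lemma orbit_rep_exists (n q : nat) (b : Aq n q) : exists s : 'S_n,
  'C[perm_coord b s | perm_coord_action n q]%act = young n (lam_of b).
Proof.
pose le_mult (k l : Zmod q) := (mult b l <= mult b k)%N.
pose vs := sort le_mult [seq k <- enum 'I_q.-1.+1 | mult b k != 0%N].
have vs_mult : [seq mult b k | k <- vs] = lam_of b :> seq nat.
  have -> : [seq mult b k | k <- vs] =
      sort geq [seq mult b k | k <- [seq k <- enum 'I_q.-1.+1 | mult b k != 0%N]].
    by rewrite sort_map.
  rewrite /= /orbit_type_seq; congr (sort _ _).
  rewrite [RHS]filter_map. by [].
have vs_uniq : uniq vs by rewrite sort_uniq filter_uniq ?enum_uniq.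
pose c := flatten [seq nseq (mult b k) k | k <- vs].
have shape_c : shape [seq nseq (mult b k) k | k <- vs] = lam_of b.
  by rewrite -vs_mult /shape -map_comp; apply: eq_map => k /=; rewrite size_nseq.
have size_c : size c == n by rewrite size_flatten shape_c sumn_parts.
have c_perm : perm_eq [tuple b ord0 i | i < n] (Tuple size_c).
  apply/allP => k _; apply/eqP => /=.
  rewrite /c count_flatten -map_comp.
  have -> : count_mem k [seq b ord0 i | i <- enum 'I_n] = mult b k.
    rewrite /mult count_map cardE -size_filter /enum_mem -!enumT.
    rewrite -filter_predI; congr size; apply: eq_filter => i.
    by rewrite /= ?inE ?andbT.
  have countE l : count_mem k (nseq (mult b l) l) = ((l == k) * mult b k)%N.
    by rewrite count_nseq /=; case: eqVneq => [->|].
  rewrite (eq_map countE) sumnE big_map -big_distrl /=.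
  case: (eqVneq (mult b k) 0%N) => [->|kn0]; first by rewrite muln0.
  have k_vs : k \in vs by rewrite mem_sort mem_filter kn0 mem_enum.
  rewrite (bigD1_seq k) //= eqxx big1 ?mul1n // => l /negPf ->.
  by [].
have /tuple_permP[s def_b] : perm_eq (Tuple size_c) [tuple b ord0 i | i < n].
  by rewrite perm_sym.
have cE i : perm_coord b s^-1%g ord0 i = nth 0 vs (reshape_index (lam_of b) i).
  rewrite mxE invgK.
  have -> : b ord0 (s i) = nth 0 c i.
    rewrite /= in def_b; rewrite def_b (nth_map i) ?size_enum_ord // nth_ord_enum tnth_mktuple.
    by [].
  rewrite /c nth_flatten shape_c.
  set r := reshape_index _ _.
  have lt_i : (i < sumn (lam_of b))%N by rewrite sumn_parts.
  have r_lt : (r < size vs)%N.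
    by rewrite -(size_map (mult b)) vs_mult reshape_indexP.
  rewrite (nth_map 0) // nth_nseq ifT //.
  have := reshape_offsetP lt_i.
  by rewrite -/r -{2}vs_mult (nth_map 0).
exists s^-1%g; apply/setP => t; apply/astab1P/keep_labelP => [fix_t i | keep_t].
  have := congr1 (fun v : Aq n q => v ord0 (t i)) fix_t.
  rewrite /= [LHS]mxE permK !cE => /eqP.
  have lt_r j : (reshape_index (lam_of b) (j : 'I_n) < size vs)%N.
    by rewrite -(size_map (mult b)) vs_mult reshape_indexP ?sumn_parts.
  by rewrite nth_uniq // => /eqP.
apply/rowP => i; rewrite mxE !cE; congr nth.
by rewrite -[in RHS](permKV t i) keep_t.
Qed.

Lemma orbit_reps_inhabited n q : inhabited (orbit_reps n q).
Proof.
have P (O : {set Aq n q}) : O \in orbits n q -> exists2 b, b \in O &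
   'C[b | perm_coord_action n q]%act = young n (orbit_type O).
  case/imsetP => b _ ->; have [s Hs] := orbit_rep_exists b.
  exists (perm_coord b s); first by apply/orbitP; exists s; rewrite ?inE.
  by rewrite orbit_typeE.
pose f (O : {set Aq n q}) := odflt 0 [pick b in O |
   'C[b | perm_coord_action n q]%act == young n (orbit_type O)].
have fP O : O \in orbits n q -> f O \in O /\
   'C[f O | perm_coord_action n q]%act = young n (orbit_type O).
  move=> /P[b bO sb]; rewrite /f; case: pickP => [c /andP[-> /eqP ->] //|].
  by move/(_ b); rewrite bO sb eqxx.
by constructor; exact:
  (OrbitReps (fun O oO => (fP O oO).1) (fun O oO => (fP O oO).2)).
Qed.

Definition has_irr_count (F : fieldType) (gT : finGroupType) (G : {group gT})
    (k : nat) : Prop :=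
  exists rs : 'I_k -> representation F G,
    [/\ forall i, mx_irreducible (rs i),
        forall i j, mx_rsim (rs i) (rs j) -> i = j
      & forall d (rho : mx_representation F G d),
          mx_irreducible rho -> exists i, mx_rsim rho (rs i)].

(* Main.v *)
From HB Require Import structures.
Require Import Defs.
From mathcomp Require Import all_boot all_order all_algebra all_fingroup.
From mathcomp Require Import all_solvable all_character.
From mathcomp Require Import reals complex mpoly.

(** Both parts follow from counting homomorphisms by traces.  Over an algebraically
    closed field of characteristic 0, the inner product cdot of the traces of two
    representations of a finite group is the dimension of the space of homomorphisms
    between them.  Hence cdot r r = 1 makes r irreducible (irr_cdot1), isomorphic
    representations have the same inner products, and irreducibles with nonzero inner
    product are isomorphic (cdot_irr_neq0).  Moreover pairwise non-isomorphic
    irreducibles are all the irreducibles as soon as their squared degrees add up to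
    the order of the group (irr_family_complete).

    Specht modules.  If two boxes of one row of la land in the same column of mu under
    g, the product row_sum la *m g *m col_sum mu vanishes.  If this never happens, la
    is dominated by mu, and for la = mu the permutation g is a row permutation times a
    column permutation (row_col_factor).  Therefore the Young symmetrizer c of la
    satisfies c x c = k c, which makes the module it generates irreducible, and
    different partitions give non-isomorphic modules.  There are at most as many
    conjugacy classes as partitions, so these are all the irreducibles of the symmetric
    group, and their squared degrees add up to its order.

    The Young subgroup of lambda is a product of symmetric groups, so inner products of
    the representations gamma are products of inner products of Specht modules
    (cdot_gamma).  For the induced representations, Mackey's formula (cdot_ind) is a sum
    over y in B_n(q), in which summing over A_n(q) first kills all the y that do not
    move b' to b.  If the orbits differ nothing is left; if b = b', the remaining y are
    those of D_lambda and the inner product is that of the representations gamma.  Hence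
    the induced representations are irreducible and pairwise non-isomorphic.  Those of
    one orbit O have squared degrees adding up to |O| n!, so all together they give
    q^n n!, the order of B_n(q), and the list is complete.

    Finally the orbits in A_n(q)^* of type lambda correspond, through the
    multiplicities of the residues, to the monomials of m_lambda in q variables
    (card_exponent_of_type), hence their number is m_lambda(1, ..., 1).  Each of them
    carries p(lambda_1) p(lambda_2) ... labels. *)

Set Implicit Arguments.
Unset Strict Implicit.
Unset Printing Implicit Defensive.

Import GRing.Theory.
Local Open Scope ring_scope.

(** * Counting homomorphisms with traces *)

Section CharacterPairing.

Variables (F : closedFieldType) (gT : finGroupType) (G : {group gT}).
Hypothesis F0 : [pchar F] =i pred0.

Local Notation reprG := (mx_representation F G).

Lemma natr_neq0 k : (0 < k)%N -> k%:R != 0 :> F.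
Proof. by rewrite ((pcharf0P F).1 F0) // lt0n. Qed.

Lemma natr_inj (j k : nat) : j%:R = k%:R :> F -> j = k.
Proof.
wlog le_jk : j k / (j <= k)%N => [hw E|].
  by case/orP: (leq_total j k) => /hw; [apply | move/(_ (esym E))].
move/eqP; rewrite eq_sym -subr_eq0 -natrB // ((pcharf0P F).1 F0) // subn_eq0 => le_kj.
by apply/eqP; rewrite eqn_leq le_jk.
Qed.

Lemma pchar0_group : ([pchar F]^'.-group G)%g.
Proof. by apply/pgroupP=> p _ _; rewrite inE /= F0. Qed.

Lemma mxtrace_idem n (P : 'M[F]_n) : P *m P = P -> \tr P = (\rank P)%:R.
Proof.
move=> PP; have := row_base_free P; have := col_base_full P; have := mulmx_base P.
move: (col_base P) (row_base P) => C R defP /row_fullP[C' CC] /row_freeP[R' RR].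
suffices RC : R *m C = 1%:M by rewrite -{1}defP mxtrace_mulC RC mxtrace1.
have : C' *m (C *m R *m (C *m R)) *m R' = C' *m (C *m R) *m R'.
  by rewrite defP PP.
by rewrite !mulmxA CC !mul1mx -!mulmxA RR mulmx1.
Qed.

Lemma mxtrace_lin_mx m n (f : {linear 'M[F]_(m, n) -> 'M[F]_(m, n)}) :
  \tr (lin_mx f) = \sum_i \sum_j f (delta_mx i j) i j.
Proof.
rewrite pair_big /= /mxtrace (reindex (uncurry (@mxvec_index m n))) /=; last first.
  exact: (curry_mxvec_bij m n).
apply: eq_bigr => -[i j] _ /=.
have -> : lin_mx f (mxvec_index i j) (mxvec_index i j) =
    row (mxvec_index i j) (lin_mx f) 0 (mxvec_index i j) by rewrite [RHS]mxE.
by rewrite rowE -mxvec_delta mul_vec_lin /= mxvecE.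
Qed.

(** The inner product of characters, with values in F itself: inverting g replaces
   complex conjugation, which F need not have. *)
Definition cdot n1 n2 (r1 : reprG n1) (r2 : reprG n2) : F :=
  #|G|%:R^-1 * \sum_(g in G) \tr (r1 g) * \tr (r2 g^-1%g).

Section Averaging.

Variables (n1 n2 : nat) (r1 : reprG n1) (r2 : reprG n2).

Definition hom_avg (X : 'M[F]_(n1, n2)) : 'M[F]_(n1, n2) :=
  #|G|%:R^-1 *: \sum_(g in G) r1 g *m X *m r2 g^-1%g.

Fact hom_avg_linear : linear hom_avg.
Proof.
move=> a X Y; rewrite /hom_avg !scaler_sumr -big_split /=.
apply: eq_bigr => g _.
by rewrite mulmxDr mulmxDl scalerDr -scalemxAr -scalemxAl !scalerA mulrC.
Qed.
HB.instance Definition _ :=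
  GRing.isLinear.Build F 'M[F]_(n1, n2) 'M[F]_(n1, n2) *:%R hom_avg hom_avg_linear.

Definition homs := lin_mx hom_avg.

Lemma hom_avgJ X h : h \in G -> r1 h *m hom_avg X = hom_avg X *m r2 h.
Proof.
move=> Gh; rewrite -scalemxAl -scalemxAr; congr (_ *: _).
rewrite mulmx_suml mulmx_sumr [RHS](reindex_inj (mulgI h)) /=.
apply: eq_big => [g|g Gg]; first by rewrite groupMl.
rewrite invMg !repr_mxM ?groupV // -!mulmxA -repr_mxM ?groupV //.
by rewrite mulVg repr_mx1 mulmx1.
Qed.

Lemma hom_avg_id X :
  (forall h, h \in G -> r1 h *m X = X *m r2 h) -> hom_avg X = X.
Proof.
move=> homX; rewrite /hom_avg (eq_bigr (fun=> X)) => [|g Gg]; last first.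
  by rewrite homX // -mulmxA -repr_mxM ?groupV // mulgV repr_mx1 mulmx1.
by rewrite sumr_const -scaler_nat scalerA mulVf ?scale1r ?natr_neq0 ?cardG_gt0.
Qed.

Lemma homsP X :
  reflect (forall h, h \in G -> r1 h *m X = X *m r2 h) (mxvec X <= homs)%MS.
Proof.
apply: (iffP idP) => [/submxP[u Du] h Gh|/hom_avg_id <-].
  have -> : X = hom_avg (vec_mx u).
    by apply: (can_inj mxvecK); rewrite Du -mul_vec_lin vec_mxK.
  exact: hom_avgJ.
by rewrite -mul_vec_lin submxMl.
Qed.

(** Averaging is a projection onto the space of homomorphisms from r1 to r2.  Its
   trace, which is the dimension of that space, splits into products of traces
   because X |-> A *m X *m B has trace \tr A * \tr B. *)
Lemma cdot_rank : cdot r1 r2 = (\rank homs)%:R.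
Proof.
rewrite -mxtrace_idem; last first.
  apply/row_matrixP => i; rewrite !rowE mulmxA -[delta_mx _ _]vec_mxK.
  rewrite !mul_vec_lin /=; congr mxvec.
  by apply: hom_avg_id => h; apply: hom_avgJ.
have avgE i j : hom_avg (delta_mx i j) i j
    = #|G|%:R^-1 * \sum_(g in G) (r1 g i i * r2 g^-1%g j j).
  rewrite mxE summxE; congr (_ * _); apply: eq_bigr => g _.
  rewrite -(mul_delta_mx (0 : 'I_1)) mulmxA -mulmxA mxE big_ord1.
  by rewrite -colE -rowE !mxE.
rewrite mxtrace_lin_mx /cdot; symmetry.
under eq_bigr => i _.
  rewrite (eq_bigr _ (fun j _ => avgE i j)) -mulr_sumr exchange_big; over.
rewrite -mulr_sumr exchange_big /=; congr (_ * _); apply: eq_bigr => g _.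
rewrite /mxtrace mulr_suml; apply: eq_bigr => i _.
by rewrite mulr_sumr.
Qed.

End Averaging.

Lemma cdot_rsim n1 n2 n3 (r1 : reprG n1) (r2 : reprG n2) (r3 : reprG n3) :
  mx_rsim r1 r2 -> cdot r3 r1 = cdot r3 r2.
Proof.
move=> sim12; congr (_ * _); apply: eq_bigr => g Gg.
by rewrite (mxtrace_rsim sim12) ?groupV.
Qed.

(** Schur's lemma over a closed field: the endomorphisms of r are the scalars. *)
Lemma cdot_irr n (r : reprG n) : mx_irreducible r -> cdot r r = 1.
Proof.
move=> irr_r; rewrite cdot_rank; suffices -> : \rank (homs r r) = 1%N by [].
have abs_r := group_closure_closed_field irr_r.
have n_gt0 : (0 < n)%N by case/mx_irrP: irr_r.
have -> : (homs r r :=: mxvec (1%:M : 'M[F]_n))%MS.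
  apply/eqmxP/andP; split; last by apply/homsP => h _; rewrite mul1mx mulmx1.
  apply/row_subP => i; rewrite -[row _ _]vec_mxK memmx1.
  apply: (mx_abs_irr_cent_scalar abs_r); apply/centgmxP => x Gx.
  by apply/esym/(homsP r r _ _ _ Gx); rewrite vec_mxK row_sub.
by rewrite rank_rV mxvec_eq0 -mxrank_eq0 mxrank1 -lt0n n_gt0.
Qed.

(** Schur's lemma: the kernel and the image of a nonzero homomorphism between
   irreducibles are trivial submodules. *)
Lemma cdot_irr_neq0 n1 n2 (r1 : reprG n1) (r2 : reprG n2) :
  mx_irreducible r1 -> mx_irreducible r2 -> cdot r1 r2 != 0 -> mx_rsim r1 r2.
Proof.
move=> /mx_irrP[_ irr1] /mx_irrP[_ irr2]; rewrite cdot_rank => nz.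
have {nz} : homs r1 r2 != 0.
  by apply: contraNneq nz => ->; rewrite mxrank0.
case/rowV0Pn => u; rewrite -[u]vec_mxK; set X := vec_mx u => /homsP homX.
rewrite mxvec_eq0 => nzX.
have kX : mxmodule r1 (kermx X).
  apply/mxmoduleP => x Gx; apply/sub_kermxP.
  by rewrite -mulmxA homX // mulmxA mulmx_ker mul0mx.
have iX : mxmodule r2 <<X>>%MS.
  rewrite (eqmx_module _ (genmxE _)); apply/mxmoduleP => x Gx.
  by rewrite -homX // submxMl.
have fX : row_free X.
  rewrite -kermx_eq0; apply: contraNT nzX => /(irr1 _ kX) ker_full.
  by rewrite -(mul1mx X); apply/eqP/sub_kermxP; rewrite sub1mx.
have gX : row_full X.
  rewrite -(eq_row_full (genmxE X)); apply: irr2 iX _.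
  by rewrite -mxrank_eq0 genmxE mxrank_eq0.
exists X => //; first by rewrite -(eqP fX) (eqP gX).
Qed.

(** The endomorphisms form a line, hence are scalars.  A submodule has a complement
   by Maschke's theorem, and the projection along it is such a scalar, which can
   only be 0 or 1. *)
Lemma irr_cdot1 n (r : reprG n) : cdot r r = 1 -> mx_irreducible r.
Proof.
rewrite cdot_rank => /(@natr_inj _ 1) rk1.
have nz1 : mxvec (1%:M : 'M[F]_n) != 0.
  rewrite mxvec_eq0; apply/eqP => z; move: rk1.
  suff -> : homs r r = 0 by rewrite mxrank0.
  apply/row_matrixP => i; rewrite -[row _ _]vec_mxK.
  by rewrite -[vec_mx _]mulmx1 z mulmx0 row0 linear0.
have sub1 : (homs r r <= mxvec (1%:M : 'M[F]_n))%MS.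
  have s : (mxvec (1%:M : 'M[F]_n) <= homs r r)%MS.
    by apply/homsP => h _; rewrite mul1mx mulmx1.
  by rewrite -(geq_leqif (mxrank_leqif_sup s)) rk1 rank_rV nz1.
apply/mx_irrP; split=> [|U modU nzU].
  rewrite lt0n; apply: contraNneq nz1 => n0.
  by rewrite mxvec_eq0 -mxrank_eq0 mxrank1 n0.
have [W modW defV dxV] := mx_Maschke_pchar r pchar0_group modU (submx1 U).
have dxUW := mxdirect_addsP dxV.
have homP : (1%:M <= dom_hom_mx r (proj_mx U W))%MS.
  by rewrite -defV proj_mx_hom.
have /is_scalar_mxP[a pa] : is_scalar_mx (proj_mx U W).
  rewrite -memmx1; apply: submx_trans sub1; apply/homsP => h Gh.
  by have := hom_mxP homP h Gh; rewrite !mul1mx.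
have idU : U *m proj_mx U W = U by rewrite proj_mx_id.
have a1 : a = 1.
  move: idU; rewrite pa mul_mx_scalar => /eqP; rewrite -subr_eq0 -{2}[U]scale1r.
  by rewrite -scalerBl scaler_eq0 (negPf nzU) orbF subr_eq0 => /eqP.
by rewrite -sub1mx -a1 -pa -[proj_mx U W]mul1mx proj_mx_sub.
Qed.

Section Families.

Variables (I : finType) (rs : I -> representation F G).
Hypothesis irr_rs : forall i, mx_irreducible (rs i).
Hypothesis rs_inj : forall i j, mx_rsim (rs i) (rs j) -> i = j.

Let sG : irrType F G := DecSocleType (regular_repr F G).
Let code i := irr_comp sG (rs i).

Let sim_code n (r : reprG n) (irr_r : mx_irreducible r) :
  mx_rsim r (irr_repr (irr_comp sG r)) := rsim_irr_comp_pchar sG pchar0_group irr_r.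

Let code_inj : injective code.
Proof.
move=> i j eq_ij; apply/rs_inj/(mx_rsim_trans (sim_code (irr_rs i))).
by rewrite -/(code i) eq_ij; apply/mx_rsim_sym/sim_code/irr_rs.
Qed.

Let deg_code i : rdegree (rs i) = irr_degree (code i).
Proof. exact: mxrank_rsim (sim_code (irr_rs i)). Qed.

Let sum_deg : (\sum_(j : sG) irr_degree j ^ 2 = #|G|)%N.
Proof.
by apply: sum_irr_degree_pchar pchar0_group _; apply: group_closure_closed_field.
Qed.

Let sum_code :
  (\sum_(j in codom code) irr_degree j ^ 2 = \sum_i rdegree (rs i) ^ 2)%N.
Proof.
rewrite (eq_bigl (mem (code @: I))) => [|j]; last first.
  by rewrite /=; apply/codomP/imsetP => [[i ->]|[i _ ->]]; exists i.
rewrite big_imset => [|i j _ _ /code_inj //].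
by apply: eq_bigr => i _; rewrite deg_code.
Qed.

(** The squared degrees of all the irreducibles add up to the order of G, which
   leaves no room for an irreducible outside the family. *)
Lemma irr_family_complete :
  (#|G| <= \sum_i rdegree (rs i) ^ 2)%N ->
  forall n (r : reprG n), mx_irreducible r -> exists i, mx_rsim r (rs i).
Proof.
move=> le_G n r irr_r.
have [/codomP[i Di]|not_code] := boolP (irr_comp sG r \in codom code).
  exists i; apply: mx_rsim_trans (sim_code irr_r) _.
  by rewrite Di; apply/mx_rsim_sym/sim_code/irr_rs.
have := sum_deg; rewrite (bigID (mem (codom code))) /= sum_code.
rewrite (bigD1 (irr_comp sG r)) //= => E; move: le_G.
rewrite -E -{2}[(\sum_i _)%N]addn0 leq_add2l leqn0 addn_eq0.
by rewrite expn_eq0 andbT gtn_eqF // irr_degree_gt0.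
Qed.

(** There are as many irreducibles as conjugacy classes, so a family of that size
   contains them all. *)
Lemma irr_family_sum_degree :
  (#|classes G| <= #|I|)%N -> (\sum_i rdegree (rs i) ^ 2 = #|G|)%N.
Proof.
rewrite -(card_irr_pchar sG pchar0_group) => [le_sI|]; last first.
  exact: group_closure_closed_field.
rewrite -sum_code -sum_deg; apply: eq_bigl => j.
exact: inj_card_onto code_inj le_sI j.
Qed.

End Families.

End CharacterPairing.

(** * Conjugacy classes of symmetric groups *)

Section CycleType.

Local Open Scope nat_scope.

Variable T : finType.
Implicit Types s t : {perm T}.

Lemma iter_perm_eq s x j k :
  (iter j s x == iter k s x) = (j == k %[mod #|porbit s x|]).
Proof.
have p_gt0 : (0 < #|porbit s x|)%N by rewrite lt0n card_porbit_neq0.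
have iter_mod l : iter l s x = iter (l %% #|porbit s x|) s x.
  rewrite {1}(divn_eq l #|porbit s x|) addnC iterD; congr iter.
  by elim: (l %/ _) => //= c IHc; rewrite mulSn iterD IHc iter_porbit.
rewrite [iter j _ _]iter_mod [iter k _ _]iter_mod.
have nthE l : iter (l %% #|porbit s x|) s x
    = nth x (traject s x #|porbit s x|) (l %% #|porbit s x|).
  by rewrite nth_traject ?ltn_mod.
by rewrite !nthE nth_uniq ?uniq_traject_porbit ?size_traject ?ltn_mod.
Qed.

Definition cycle_type s : seq nat := sort geq [seq #|X| | X : {set T} in porbits s].

(** Sorting the cycles of s and those of t by size pairs cycles of equal size. *)
Lemma cycle_type_bij s t : cycle_type s = cycle_type t ->
  exists f : {set T} -> {set T},
    [/\ {in porbits s, forall X, f X \in porbits t},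
        {in porbits s, forall X, #|f X| = #|X|}
      & {in porbits s &, injective f}].
Proof.
pose c (X : {set T}) := #|X|.
pose e u := sort (relpre c geq) (enum (porbits u)).
have mem_e u : e u =i porbits u by move=> X; rewrite mem_sort mem_enum.
have map_e u : map c (e u) = cycle_type u by rewrite -sort_map.
move=> eq_st; have size_e : size (e s) = size (e t).
  by rewrite -(size_map c) map_e eq_st -map_e size_map.
have ltX X : X \in porbits s -> (index X (e s) < size (e t))%N.
  by rewrite -size_e index_mem mem_e.
exists (fun X => nth set0 (e t) (index X (e s))); split=> [X sX|X sX|X Y sX sY].
- by rewrite -mem_e mem_nth ?ltX.
- rewrite -/(c _) -(nth_map _ 0%N c) ?ltX // map_e -eq_st -map_e.
  by rewrite (nth_map set0) ?size_e ?ltX // nth_index ?mem_e.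
- move/eqP; rewrite nth_uniq ?ltX ?sort_uniq ?enum_uniq //.
  by move=> /eqP eq_i; rewrite -[X](nth_index set0 (s := e s)) ?mem_e //
                             eq_i nth_index ?mem_e.
Qed.

(** The conjugating permutation follows each cycle of s and its partner in t in
   parallel, starting from a chosen point in each. *)
Lemma cycle_type_conj s t : cycle_type s = cycle_type t -> exists h, (s ^ h)%g = t.
Proof.
case/cycle_type_bij => f [f_t card_f f_inj].
have sX i : porbit s i \in porbits s by apply: imset_f.
(* The chosen starting points; both depend on the cycle of i alone (r_orb below). *)
pose r i := odflt i [pick y in porbit s i].
pose r' i := odflt i [pick y in f (porbit s i)].
have rP i : porbit s (r i) = porbit s i.
  rewrite /r; case: pickP => [y|/(_ i)] /=; last by rewrite porbit_id.
  by rewrite -eq_porbit_mem => /eqP.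
have r'P i : porbit t (r' i) = f (porbit s i).
  have /imsetP[y _ Dy] := f_t _ (sX i).
  rewrite /r' Dy; case: pickP => [z|/(_ y)] /=; last by rewrite porbit_id.
  by rewrite -eq_porbit_mem => /eqP.
have r_orb i j : porbit s i = porbit s j -> r i = r j /\ r' i = r' j.
  move=> eq_ij; rewrite /r /r' eq_ij; split; case: pickP => // none.
    by have := none j; rewrite porbit_id.
  have /imsetP[y _ Dy] := f_t _ (sX j).
  by have := none y; rewrite /= Dy porbit_id.
have iterP i : exists k, iter k s (r i) == i.
  have /porbitP[k Dk] : i \in porbit s (r i) by rewrite rP porbit_id.
  by exists k; rewrite -permX -Dk.
pose k i := xchoose (iterP i).
have kP i : iter (k i) s (r i) = i by apply/eqP/(xchooseP (iterP i)).
have eq_iter i a b :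
    (iter a t (r' i) == iter b t (r' i)) = (iter a s (r i) == iter b s (r i)).
  by rewrite !iter_perm_eq r'P card_f // rP.
pose h i := iter (k i) t (r' i).
have h_s i : h (s i) = t (h i).
  have [eq_r eq_r'] : r (s i) = r i /\ r' (s i) = r' i.
    by apply: r_orb; have := porbit_perm s 1 i; rewrite expg1.
  rewrite /h eq_r' -[t _]/(iter (k i).+1 t _); apply/eqP; rewrite eq_iter /= kP.
  by rewrite -eq_r kP.
have h_inj : injective h.
  move=> i j eq_h.
  have porb_h l : porbit t (h l) = f (porbit s l).
    by rewrite /h -permX porbit_perm r'P.
  have [eq_r eq_r'] : r i = r j /\ r' i = r' j.
    by apply/r_orb/f_inj => //; rewrite -!porb_h eq_h.
  by move/eqP: eq_h; rewrite /h -eq_r' eq_iter {2}eq_r !kP => /eqP.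
exists (perm h_inj); apply/permP => i.
rewrite -(permKV (perm h_inj) i); set j := (perm h_inj)^-1%g i.
by rewrite permJ !permE h_s.
Qed.

End CycleType.

Lemma cycle_type_part m (s : 'S_m) : is_part m (cycle_type s).
Proof.
apply/and3P; split.
- by apply: sort_sorted => i j; exact: leq_total.
- rewrite mem_sort; apply/imageP => -[X /imsetP[x _ ->]] /esym/eqP.
  by rewrite (negPf (card_porbit_neq0 _ _)).
rewrite /cycle_type (perm_sumn (permEl (perm_sort _ _))) sumnE big_map big_enum /=.
rewrite -[X in _ == X]card_ord -sum1_card.
rewrite (partition_big (porbit s) (mem (porbits s))) => [|i _]; last exact: imset_f.
apply/eqP/eq_bigr => X /imsetP[x _ ->]; rewrite -sum1_card; apply: eq_bigl => y.
by rewrite /= eq_porbit_mem.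
Qed.

(** Permutations with the same cycle type are conjugate, so the cycle type is an
   injection from classes to partitions. *)
Lemma card_classes_perm m : (#|classes [set: 'S_m]| <= npart m)%N.
Proof.
pose ct (C : {set 'S_m}) := IntPart (cycle_type_part (repr C)).
rewrite -(card_in_imset (f := ct)) ?max_card // => C D /imsetP[s _ ->] /imsetP[t _ ->].
have reprP (u : 'S_m) : exists v, repr (u ^: [set: 'S_m])%g = (u ^ v)%g.
  by have /imsetP[v _ ->] := mem_repr_classes (mem_classes (in_setT u)); exists v.
have [[v Dv] [w Dw]] := (reprP s, reprP t).
move=> /(congr1 val) /= /cycle_type_conj[h]; rewrite Dv Dw => eq_h.
rewrite -(classGidl s (in_setT v)) -(classGidl (s ^ v)%g (in_setT h)) eq_h.
by rewrite classGidl ?in_setT.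
Qed.

(** * Rows and columns of diagrams *)

Lemma geq_trans : transitive geq.
Proof. by move=> x y z /= le1 le2; apply: leq_trans le2 le1. Qed.

Section Boxes.

Local Open Scope nat_scope.

Variable m : nat.

Section OnePartition.

Variable la : seq nat.
Hypothesis laP : is_part m la.

Let la_sum : sumn la = m. Proof. by case/and3P: laP => _ _ /eqP. Qed.

Lemma part_sorted j k : j <= k -> nth 0 la k <= nth 0 la j.
Proof.
move=> le_jk; have [lt_k|/(nth_default 0)-> //] := ltnP k (size la).
have la_s : sorted geq la by case/and3P: laP.
by apply: (sorted_leq_nth geq_trans leqnn 0 la_s); rewrite ?inE ?(leq_ltn_trans le_jk).
Qed.

Lemma box_col_lt (i : 'I_m) : reshape_offset la i < nth 0 la (reshape_index la i).
Proof. by apply: reshape_offsetP; rewrite la_sum. Qed.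

Lemma col_lt (i : 'I_m) : reshape_offset la i < m.
Proof.
apply: leq_trans (box_col_lt i) _; rewrite -[X in _ <= X]la_sum.
by apply: mem_leq_sumn; rewrite mem_nth // reshape_indexP // la_sum.
Qed.

Lemma box_inj (i j : 'I_m) : reshape_index la i = reshape_index la j ->
  reshape_offset la i = reshape_offset la j -> i = j.
Proof.
move=> eq_r eq_c; apply/val_inj.
by rewrite -[LHS](reshape_indexK la) eq_r eq_c reshape_indexK.
Qed.

Lemma box_exists k c : c < nth 0 la k ->
  exists i : 'I_m, reshape_index la i = k /\ reshape_offset la i = c.
Proof.
move=> lt_c; have lt_i : flatten_index la k c < m.
  by rewrite -la_sum flatten_indexP.
by exists (Ordinal lt_i); rewrite flatten_indexKl ?flatten_indexKr.
Qed.

Lemma card_row k : #|[set i : 'I_m | reshape_index la i == k]| = nth 0 la k.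
Proof.
rewrite -[RHS](card_ord); pose f (i : 'I_m) := reshape_offset la i.
have -> : #|'I_(nth 0 la k)| = size (iota 0 (nth 0 la k)) by rewrite card_ord size_iota.
rewrite cardE -(size_map f); apply/perm_size/uniq_perm; rewrite ?iota_uniq //.
  rewrite map_inj_in_uniq ?enum_uniq // => i j; rewrite !mem_enum !inE.
  by move=> /eqP ri /eqP rj; apply: box_inj; rewrite ri rj.
move=> c; rewrite mem_iota add0n; apply/mapP/idP => [[x] |/box_exists[i [ri ci]]].
  by rewrite mem_enum inE => /eqP <- ->; apply: box_col_lt.
by exists i; rewrite ?mem_enum ?inE ?ri.
Qed.

End OnePartition.

Section Comparison.

Variables (la mu : seq nat) (g : 'S_m).
Hypotheses (laP : is_part m la) (muP : is_part m mu).
Hypothesis g_inj : forall i j : 'I_m, reshape_index la i = reshape_index la j ->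
  reshape_offset mu (g i) = reshape_offset mu (g j) -> i = j.

Local Notation below K c :=
  #|[set i : 'I_m | (reshape_index la i < K) && (reshape_offset mu (g i) == c)]|.
Local Notation above K c :=
  #|[set j : 'I_m | (reshape_index mu j < K) && (reshape_offset mu j == c)]|.

(** In below K c at most one box comes from each of the first K rows of la, and no
   more boxes than column c of mu has.  The rows of mu that meet column c are the
   first ones, so above K c equals one of these two bounds. *)
Lemma leq_box_count K c : below K c <= above K c.
Proof.
case: K => [|K]; first by rewrite eq_card0 // => i; rewrite inE.
have [lt_c|ge_c] := ltnP c (nth 0 mu K).
  apply: (@leq_trans K.+1).
    pose f (i : 'I_m) := inord (reshape_index la i) : 'I_K.+1.
    rewrite -[X in _ <= X](card_ord K.+1) -(card_in_imset (f := f)) ?max_card //.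
    move=> i j; rewrite !inE => /andP[ri /eqP ci] /andP[rj /eqP cj].
    move=> /(congr1 val); rewrite /= !inordK // => eq_r.
    by apply: g_inj; rewrite ?ci ?cj.
  have box (k : 'I_K.+1) : {j : 'I_m | (reshape_index mu j == k)
                                       && (reshape_offset mu j == c)}.
    apply/sigW; have lt_ck : c < nth 0 mu k.
      by apply: leq_trans lt_c _; apply: (part_sorted muP); rewrite -ltnS.
    by have [j [rj cj]] := box_exists muP lt_ck; exists j; rewrite rj cj !eqxx.
  pose f k := sval (box k).
  have fr k : reshape_index mu (f k) = k.
    by rewrite /f; case: (box k) => j /= /andP[/eqP].
  have f_inj : injective f by move=> k l eq_f; apply/val_inj; rewrite /= -!fr eq_f.
  rewrite -[X in X <= _](card_ord K.+1) -(card_imset _ f_inj).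
  apply/subset_leq_card/subsetP => _ /imsetP[k _ ->]; rewrite inE fr ltn_ord.
  by rewrite /f; case: (box k) => j /= /andP[_].
rewrite -(card_imset _ (@perm_inj _ g)); apply/subset_leq_card/subsetP => j.
case/imsetP => i; rewrite !inE => /andP[_ /eqP ci] ->; rewrite ci eqxx andbT.
rewrite ltnNge; apply/negP => lt_K.
have := box_col_lt muP (g i); rewrite ci ltnNge; apply/negP/negPn.
by apply: leq_trans ge_c; apply: (part_sorted muP) (ltnW lt_K).
Qed.

Let sum_below K : \sum_(c < m) below K c = #|[set i : 'I_m | reshape_index la i < K]|.
Proof.
pose col (i : 'I_m) := Ordinal (col_lt muP (g i)).
rewrite -sum1_card [RHS](partition_big col xpredT) //=; apply: eq_bigr => c _.
by rewrite -sum1_card; apply: eq_bigl => i; rewrite !inE -val_eqE.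
Qed.

Let sum_above K : \sum_(c < m) above K c = #|[set i : 'I_m | reshape_index mu i < K]|.
Proof.
pose col (i : 'I_m) := Ordinal (col_lt muP i).
rewrite -sum1_card [RHS](partition_big col xpredT) //=; apply: eq_bigr => c _.
by rewrite -sum1_card; apply: eq_bigl => i; rewrite !inE -val_eqE.
Qed.

(** The dominance order between la and mu, obtained by adding up leq_box_count over
   the columns of mu. *)
Lemma separated_dominated K :
  #|[set i : 'I_m | reshape_index la i < K]|
    <= #|[set i : 'I_m | reshape_index mu i < K]|.
Proof. by rewrite -sum_below -sum_above leq_sum // => c _; apply: leq_box_count. Qed.

(** For la = mu the inequalities of leq_box_count have equal sums, so they are
   equalities; subtracting those for two successive K gives one for each single
   row and column. *)
Lemma separated_box (i : 'I_m) : la = mu ->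
  exists j : 'I_m, reshape_index mu j = reshape_index la i
                   /\ reshape_offset mu j = reshape_offset mu (g i).
Proof.
move=> eq_lm.
have eq_count K (c : 'I_m) : below K c = above K c.
  have leK (d : 'I_m) : true ->
      below K d <= above K d ?= iff (below K d == above K d).
    by split; [apply: leq_box_count | ].
  have [_] := leqif_sum (P := xpredT) leK.
  by rewrite sum_below sum_above eq_lm eqxx => /esym/forallP/(_ c)/eqP.
pose k := reshape_index la i; pose c := Ordinal (col_lt muP (g i)).
have lt_count : below k c < below k.+1 c.
  apply/proper_card/properP; split.
    by apply/subsetP => l; rewrite !inE => /andP[/ltnW lt_k ->]; rewrite ltnS lt_k.
  by exists i; rewrite !inE -/k ?ltnSn ?ltnn ?eqxx.
rewrite !eq_count in lt_count.
have /subsetPn[j] : ~~ ([set j : 'I_m | (reshape_index mu j < k.+1)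
                       && (reshape_offset mu j == c)] \subset
  [set j : 'I_m | (reshape_index mu j < k) && (reshape_offset mu j == c)]).
  by apply: contraL lt_count => /subset_leq_card; rewrite -leqNgt.
rewrite !inE ltnS => /andP[le_k cj]; rewrite cj andbT -leqNgt => ge_k.
by exists j; split; apply/eqP; rewrite // eqn_leq le_k.
Qed.

End Comparison.

(** Dominance is antisymmetric, as the row lengths are the differences of the
   partial sums that it compares. *)
Lemma separated_antisym la mu (g h : 'S_m) : is_part m la -> is_part m mu ->
  (forall i j : 'I_m, reshape_index la i = reshape_index la j ->
     reshape_offset mu (g i) = reshape_offset mu (g j) -> i = j) ->
  (forall i j : 'I_m, reshape_index mu i = reshape_index mu j ->
     reshape_offset la (h i) = reshape_offset la (h j) -> i = j) ->
  la = mu.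
Proof.
move=> laP muP g_inj h_inj.
have eqD K : #|[set i : 'I_m | reshape_index la i < K]|
    = #|[set i : 'I_m | reshape_index mu i < K]|.
  apply/eqP; rewrite eqn_leq (separated_dominated muP g_inj).
  exact: separated_dominated laP h_inj K.
have cardS nu k : #|[set i : 'I_m | reshape_index nu i < k.+1]|
    = #|[set i : 'I_m | reshape_index nu i < k]|
      + #|[set i : 'I_m | reshape_index nu i == k]|.
  rewrite -cardsUI [X in _ + X]eq_card0 ?addn0; last first.
    by move=> i; rewrite !inE; case: ltngtP.
  by apply: eq_card => i; rewrite !inE ltnS leq_eqVlt orbC.
have eq_nth k : nth 0 la k = nth 0 mu k.
  rewrite -(card_row laP) -(card_row muP); apply/eqP.
  rewrite -(eqn_add2l #|[set i : 'I_m | reshape_index la i < k]|).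
  by rewrite -cardS eqD cardS eqD.
have size_le nu nu' : is_part m nu -> (forall k, nth 0 nu k = nth 0 nu' k) ->
    size nu <= size nu'.
  case/and3P=> _ no0 _ eq_n; rewrite leqNgt; apply: contra no0 => lt_s.
  by rewrite -(nth_default 0 (leqnn (size nu'))) -eq_n mem_nth.
apply: (eq_from_nth (x0 := 0)) => [|k _]; last exact: eq_nth.
by apply/eqP; rewrite eqn_leq !size_le.
Qed.

(** The row part p moves each box inside its row into the column that g sends it
   to; separated_box says that the diagram has such a box. *)
Lemma row_col_factor la (g : 'S_m) : is_part m la ->
  (forall i j : 'I_m, reshape_index la i = reshape_index la j ->
     reshape_offset la (g i) = reshape_offset la (g j) -> i = j) ->
  exists p q, [/\ p \in young m la, q \in col_young m la & g = (p * q)%g].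
Proof.
move=> laP g_inj.
have [f fP] := fin_all_exists (fun i => separated_box laP g_inj i (erefl la)).
have fr i : reshape_index la (f i) = reshape_index la i by case: (fP i).
have fc i : reshape_offset la (f i) = reshape_offset la (g i) by case: (fP i).
have f_inj : injective f.
  by move=> i j eq_f; apply: g_inj; rewrite -?(fr i) -?(fc i) eq_f ?fr ?fc.
exists (perm f_inj), ((perm f_inj)^-1 * g)%g; split; last by rewrite mulKVg.
  by apply/keep_labelP => i; rewrite permE fr.
apply/keep_labelP => i; rewrite permM -fc -[f _](permE f_inj).
by rewrite permKV.
Qed.

Lemma young_col_young1 la (s : 'S_m) :
  s \in young m la -> s \in col_young m la -> s = 1%g.
Proof.
move=> /keep_labelP rs /keep_labelP cs; apply/permP => i; rewrite perm1.
exact: box_inj (rs i) (cs i).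
Qed.

End Boxes.

(** * Specht modules *)

Section SpechtModules.

Variables (F : closedFieldType) (m : nat).
Hypothesis F0 : [pchar F] =i pred0.

Local Notation G := [set: 'S_m]%G.
Local Notation aG := (regular_repr F G).
Local Notation RG := (group_ring F G).
Local Notation e1 := (delta_mx 0 (gring_index G 1%g) : 'rV[F]_#|G|).

Definition row_sum (la : seq nat) : 'M[F]_#|G| := \sum_(s in young m la) aG s.

Definition col_sum (la : seq nat) : 'M[F]_#|G| :=
  \sum_(t in col_young m la) (-1) ^+ odd_perm t *: aG t.

Definition symmetrizer (la : seq nat) : 'M[F]_#|G| := row_sum la *m col_sum la.

Lemma e1_aG s : e1 *m aG s = delta_mx 0 (gring_index G s).
Proof. by rewrite -rowE rowK gring_indexK ?inE // mul1g. Qed.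

Lemma young_symmetrizerE la : young_symmetrizer F m la = e1 *m symmetrizer la.
Proof.
rewrite /symmetrizer /row_sum /col_sum mulmx_suml mulmx_sumr; apply: eq_bigr => s _.
rewrite !mulmx_sumr; apply: eq_bigr => t _.
by rewrite -!scalemxAr -repr_mxM ?inE // e1_aG.
Qed.

Lemma row_sum_aG la p : p \in young m la -> row_sum la *m aG p = row_sum la.
Proof.
move=> Yp; rewrite /row_sum mulmx_suml [RHS](reindex_inj (mulIg p)) /=.
by apply: eq_big => [s|s _]; rewrite ?groupMr // repr_mxM ?inE.
Qed.

Lemma aG_col_sum la q : q \in col_young m la ->
  aG q *m col_sum la = (-1) ^+ odd_perm q *: col_sum la.
Proof.
move=> Yq; rewrite /col_sum mulmx_sumr scaler_sumr [RHS](reindex_inj (mulgI q)) /=.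
apply: eq_big => [t|t _]; first by rewrite groupMl.
rewrite -scalemxAr repr_mxM ?inE // scalerA odd_permM signr_addb mulrA.
by rewrite -signr_addb addbb mul1r.
Qed.

Lemma symmetrizer_neq0 la : young_symmetrizer F m la != 0.
Proof.
apply/eqP => /rowP/(_ (gring_index G 1%g)) /eqP; rewrite mxE summxE.
have idx1 s t : (s * t)%g != 1%g ->
    (delta_mx 0 (gring_index G (s * t)%g) : 'rV[F]_#|G|) 0 (gring_index G 1%g) = 0.
  move=> ne1; rewrite mxE /=; case: eqP => // eq_i; case/eqP: ne1.
  by rewrite -(gring_indexK (G := G) (s * t)%g) ?inE // -eq_i gring_indexK ?inE.
rewrite (bigD1 1%g) ?group1 //= [X in _ + X]big1 ?addr0 => [|s /andP[Ys ns]].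
  rewrite summxE (bigD1 1%g) ?group1 //= [X in _ + X]big1 ?addr0 => [|t /andP[Yt nt]].
    by rewrite odd_perm1 scale1r mulg1 mxE !eqxx oner_eq0.
  by rewrite mxE idx1 ?mulr0 // mul1g.
rewrite summxE big1 // => t Yt; rewrite mxE idx1 ?mulr0 //.
apply: contra ns => /eqP st1; apply/eqP/(young_col_young1 Ys).
by rewrite -[s]invgK groupV (mulg1_eq st1).
Qed.

Lemma sum_mem la : (row_sum la \in RG)%MS * (col_sum la \in RG)%MS.
Proof.
split; rewrite /row_sum /col_sum linear_sum summx_sub // => s _ /=.
  by rewrite envelop_mx_id ?inE.
by rewrite linearZ scalemx_sub // envelop_mx_id ?inE.
Qed.

Lemma symmetrizer_mem la : (symmetrizer la \in RG)%MS.
Proof. by apply: envelop_mxM; rewrite sum_mem. Qed.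

(** The transposition t of i and j preserves rows and its conjugate by g preserves
   columns; moving t through g shows that the product equals its opposite. *)
Lemma row_col_sum0 la mu (g : 'S_m) (i j : 'I_m) : i != j ->
  reshape_index la i = reshape_index la j ->
  reshape_offset mu (g i) = reshape_offset mu (g j) ->
  row_sum la *m aG g *m col_sum mu = 0.
Proof.
move=> ne_ij eq_r eq_c; set X := _ *m _.
have Yt : tperm i j \in young m la.
  by apply/keep_labelP => k; case: tpermP => [->|->|].
have Yt' : tperm (g i) (g j) \in col_young m mu.
  by apply/keep_labelP => k; case: tpermP => [->|->|].
suffices : X = - X.
  move/eqP; rewrite -subr_eq0 opprK -mulr2n -scaler_nat scaler_eq0.
  by rewrite (negPf (natr_neq0 F0 (ltn0Sn 1))) => /eqP.
rewrite {1}/X -(row_sum_aG Yt) -(mulmxA (row_sum la)) -repr_mxM ?inE //.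
have -> : (tperm i j * g = g * tperm (g i) (g j))%g.
  by rewrite -tpermJ conjgE !mulgA mulgV mul1g.
rewrite repr_mxM ?inE // !mulmxA -(mulmxA _ (aG (tperm _ _))) aG_col_sum //.
by rewrite odd_tperm (inj_eq perm_inj) ne_ij expr1 scaleN1r mulmxN.
Qed.

Lemma row_col_sumP la mu (g : 'S_m) : row_sum la *m aG g *m col_sum mu != 0 ->
  forall i j : 'I_m, reshape_index la i = reshape_index la j ->
    reshape_offset mu (g i) = reshape_offset mu (g j) -> i = j.
Proof.
move=> nz i j eq_r eq_c; apply/eqP; apply: contraNT nz => ne_ij.
by rewrite (row_col_sum0 ne_ij eq_r eq_c).
Qed.

Lemma group_ring_sandwich (A B C X : 'M[F]_#|G|) :
  (forall g, exists k, A *m aG g *m B = k *: C) -> (X \in RG)%MS ->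
  exists k, A *m X *m B = k *: C.
Proof.
move=> /fin_all_exists[k kP] /envelop_mxP[x ->]; exists (\sum_g x g * k g).
rewrite mulmx_sumr mulmx_suml scaler_suml; apply: eq_big => [g|g _].
  by rewrite inE.
by rewrite -scalemxAr -scalemxAl kP scalerA.
Qed.

(** The terms row_sum la *m aG g *m col_sum la vanish unless g is the product of a
   row permutation and a column one, which the two sums absorb up to a sign. *)
Lemma symmetrizer_scalar la X : is_part m la -> (X \in RG)%MS ->
  exists k, symmetrizer la *m X *m symmetrizer la = k *: symmetrizer la.
Proof.
move=> laP RX; have := envelop_mxM (envelop_mxM (sum_mem la).2 RX) (sum_mem la).1.
have -> : symmetrizer la *m X *m symmetrizer la
    = row_sum la *m (col_sum la *m X *m row_sum la) *m col_sum la.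
  by rewrite /symmetrizer !mulmxA.
apply: group_ring_sandwich => g.
have [->|] := eqVneq (row_sum la *m aG g *m col_sum la) 0.
  by exists 0; rewrite scale0r.
move/row_col_sumP/(row_col_factor laP) => [p [q [Yp Yq ->]]].
exists ((-1) ^+ odd_perm q); rewrite repr_mxM ?inE // mulmxA row_sum_aG //.
by rewrite -mulmxA aG_col_sum // scalemxAr.
Qed.

Local Notation cyc la := (cyclic_mx aG (young_symmetrizer F m la)).

(** The right ideal W lies in the one generated by the symmetrizer, which it kills,
   so W squares to zero.  By Maschke's theorem W has a complement W'; splitting the
   unit as w + w' along it gives u = w' u for u in W, which is thus in W' too. *)
Lemma cyclic_symmetrizer_eq0 la (W : 'M[F]_#|G|) : mxmodule aG W ->
  (W <= cyc la)%MS -> W *m symmetrizer la = 0 -> W = 0.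
Proof.
move=> modW sWU WC0.
have [W' modW' defV dxV] := mx_Maschke_pchar aG (pchar0_group G F0) modW (submx1 W).
have gr_mem u : (gring_mx aG u \in RG)%MS by rewrite vec_mxK submxMl.
have mul_e1 u : e1 *m gring_mx aG u = u by rewrite -rowE -[RHS]gring_mxK.
have [[w w'] /= De1] : exists w, e1 = w.1 *m W + w.2 *m W'.
  by apply/sub_addsmxP; rewrite defV submx1.
have kill u v : (u <= W)%MS -> (v <= W)%MS -> u *m gring_mx aG v = 0.
  move=> Wu Wv; have /cyclic_mxP[X RX Dv] := submx_trans Wv sWU.
  have -> : gring_mx aG v = symmetrizer la *m X.
    rewrite Dv young_symmetrizerE; have /envelop_mxP[x ->] := RX.
    have /submxP[c Dc] := symmetrizer_mem la.
    have -> : symmetrizer la = gring_mx aG c by rewrite /gring_mx /= -Dc mxvecK.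
    rewrite mul_e1 mulmx_sumr linear_sum /= mulmx_sumr; apply: eq_bigr => g _.
    by rewrite -!scalemxAr linearZ /= gring_mxJ ?inE.
  by rewrite mulmxA; have /submxP[a ->] := Wu; rewrite -(mulmxA a) WC0 mulmx0 mul0mx.
have dxW := mxdirect_addsP dxV.
apply/eqP/rowV0P => u Wu.
have : (u <= W :&: W')%MS; last by rewrite dxW submx0 => /eqP.
rewrite sub_capmx Wu -[u]mul_e1 {1}De1 mulmxDl kill ?submxMl // add0r.
exact: mxmodule_envelop modW' (gr_mem u) (submxMl _ _).
Qed.

(** Multiplication by the symmetrizer maps a nonzero submodule into itself, onto a
   line spanned by the generator. *)
Lemma specht_irr la : is_part m la -> mx_irreducible (specht F m la).
Proof.
move=> laP; apply/submod_mx_irr; split; first exact: cyclic_mx_module.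
  by rewrite cyclic_mx_eq0 symmetrizer_neq0.
move=> W modW sWU nzW; apply: cyclic_mx_sub => //.
have /rowV0Pn[u] : W *m symmetrizer la != 0.
  by apply: contraNneq nzW => /(cyclic_symmetrizer_eq0 modW sWU) ->.
case/submxP => a ->; rewrite mulmxA; set w := a *m W => nzw.
have Ww : (w <= W)%MS by apply: submxMl.
have /cyclic_mxP[X RX Dw] := submx_trans Ww sWU.
have [k Dk] := symmetrizer_scalar laP RX.
have wC : w *m symmetrizer la = k *: young_symmetrizer F m la.
  by rewrite Dw young_symmetrizerE scalemxAr -Dk !mulmxA.
have nzk : k != 0 by apply: contraNneq nzw => k0; rewrite wC k0 scale0r.
rewrite -(scale1r (young_symmetrizer _ _ _)) -(mulVf nzk) -scalerA -wC.
by rewrite scalemx_sub // (mxmodule_envelop modW (symmetrizer_mem la) Ww).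
Qed.

(** Otherwise the symmetrizer of la kills the module of mu, hence also that of la,
   which cyclic_symmetrizer_eq0 forbids. *)
Lemma specht_rsim_row_col la mu : mx_rsim (specht F m la) (specht F m mu) ->
  exists g, row_sum mu *m aG g *m col_sum la != 0.
Proof.
move=> /mx_rsim_iso[f uf hom_f def_f].
apply/existsP; apply: contraT; rewrite negb_exists => /forallP all0.
have kill_la (X : 'M[F]_#|G|) : (X \in RG)%MS ->
    symmetrizer mu *m X *m symmetrizer la = 0.
  move=> RX; have := envelop_mxM (envelop_mxM (sum_mem mu).2 RX) (sum_mem la).1.
  have -> : symmetrizer mu *m X *m symmetrizer la
      = row_sum mu *m (col_sum mu *m X *m row_sum la) *m col_sum la.
    by rewrite /symmetrizer !mulmxA.
  move=> RY; have [g|k ->] := @group_ring_sandwich (row_sum mu) (col_sum la) 0 _ _ RY.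
    by exists 0; rewrite scaler0; apply/eqP/negPn.
  by rewrite scaler0.
have cyc_mu0 : cyc mu *m symmetrizer la = 0.
  apply/row_matrixP => i; rewrite row_mul row0.
  have /cyclic_mxP[X RX ->] := row_sub i (cyc mu).
  by rewrite young_symmetrizerE -!(mulmxA e1) kill_la // mulmx0.
have : cyc la = 0.
  apply: (cyclic_symmetrizer_eq0 (la := la)) => //; first exact: cyclic_mx_module.
  apply: (can_inj (mulmxK uf)); rewrite mul0mx.
  rewrite (hom_envelop_mxC hom_f (symmetrizer_mem la)).
  have /submxP[a ->] : (cyc la *m f <= cyc mu)%MS by rewrite def_f.
  by rewrite -mulmxA cyc_mu0 mulmx0.
by move/eqP; rewrite cyclic_mx_eq0 (negPf (symmetrizer_neq0 la)).
Qed.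

(** An isomorphism and its inverse give permutations separating la from mu and mu
   from la, so that each partition dominates the other. *)
Lemma specht_inj la mu : is_part m la -> is_part m mu ->
  mx_rsim (specht F m la) (specht F m mu) -> la = mu.
Proof.
move=> laP muP sim; have [g /row_col_sumP g_sep] := specht_rsim_row_col sim.
have [h /row_col_sumP h_sep] := specht_rsim_row_col (mx_rsim_sym sim).
exact: separated_antisym laP muP h_sep g_sep.
Qed.

Lemma cdot_specht la mu : is_part m la -> is_part m mu ->
  cdot (specht F m la) (specht F m mu) = (la == mu)%:R.
Proof.
move=> laP muP; have [->|ne] := eqVneq la mu.
  by rewrite cdot_irr //; apply: specht_irr.
apply/eqP; apply: contraNT ne => /(cdot_irr_neq0 F0 (specht_irr laP) (specht_irr muP)).
by move/(specht_inj laP muP) => ->.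
Qed.

(** The Specht modules are all the irreducibles, by card_classes_perm. *)
Lemma sum_specht_degree :
  (\sum_(la : intpart m) \rank (cyc la) ^ 2 = #|[set: 'S_m]|)%N.
Proof.
pose rs (la : intpart m) := Representation (specht F m la).
apply: (irr_family_sum_degree F0 (rs := rs)).
- by move=> la; apply/specht_irr/partsP.
- by move=> la mu /= /(specht_inj (partsP la) (partsP mu)) /val_inj.
- exact: card_classes_perm.
Qed.

End SpechtModules.

(** * Young subgroups and outer tensor products *)

Section YoungProduct.

Variables (n : nat) (lam : intpart n).

Local Notation I := 'I_(size lam).
Local Notation part k := (nth 0%N lam k).
Local Notation blocks := (fprod (fun k : I => ('S_(part k) : finType))).

Let lt_i (i : 'I_n) : (i < sumn lam)%N. Proof. by rewrite sumn_parts. Qed.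

Definition block_of (i : 'I_n) : I := Ordinal (reshape_indexP (lt_i i)).

Definition offset_of (i : 'I_n) : 'I_(part (block_of i)) :=
  Ordinal (reshape_offsetP (lt_i i)).

Lemma block_pos_offset i : block_pos (offset_of i) = i.
Proof. by apply/val_inj; rewrite /= reshape_indexK. Qed.

(** The inverse of cut below: the permutation that acts on the k-th block as t k. *)
Definition glue_fun (t : blocks) (i : 'I_n) : 'I_n :=
  block_pos (t (block_of i) (offset_of i)).

Lemma glue_block_pos t (k : I) (j : 'I_(part k)) :
  glue_fun t (block_pos j) = block_pos (t k j).
Proof.
rewrite /glue_fun.
have : block_of (block_pos j) = k.
  by apply/val_inj; rewrite /= flatten_indexKl.
have : offset_of (block_pos j) = j :> nat by rewrite /= flatten_indexKr.
move: (block_of _) (offset_of _) => k' o eq_o eq_k.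
by case: k / eq_k j eq_o => j eq_o; congr (block_pos (t _ _)); apply: val_inj.
Qed.

Lemma glue_inj t : injective (glue_fun t).
Proof.
pose t' : blocks := [fprod k => (t k)^-1%g].
apply: (can_inj (g := glue_fun t')) => i.
rewrite {2}/glue_fun glue_block_pos fprodE permK; exact: block_pos_offset.
Qed.

Definition glue (t : blocks) : 'S_n := perm (@glue_inj t).

Lemma glue_young t : glue t \in young n lam.
Proof.
by apply/keep_labelP => i; rewrite permE /= flatten_indexKl.
Qed.

Definition cut (s : 'S_n) : blocks := [fprod k : I => block_perm lam k s].

Lemma cutK s : (glue (cut s) == s) = (s \in young n lam).
Proof.
apply/eqP/idP => [<-|ys]; first exact: glue_young.
apply/permP => i; rewrite permE -{1}(block_pos_offset i) glue_block_pos fprodE.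
by rewrite -block_permP ?block_pos_offset.
Qed.

Lemma glueK : cancel glue cut.
Proof.
move=> t; apply/fprodP => k; rewrite fprodE; apply/permP => j.
apply: block_pos_inj; rewrite -block_permP ?glue_young //.
by rewrite permE glue_block_pos.
Qed.

(** By cutK and glueK, cut is a bijection from the Young subgroup to the product of
   the symmetric groups of the blocks; then sums of products distribute. *)
Lemma sum_young (R : comNzSemiRingType) (f : forall k : I, 'S_(part k) -> R) :
  \sum_(s in young n lam) \prod_(k : I) f k (block_perm lam k s)
    = \prod_(k : I) \sum_(t : 'S_(part k)) f k t.
Proof.
transitivity (\sum_(t : blocks) \prod_(k : I) f k (t k)).
  rewrite [RHS](reindex_onto cut glue) => [|t _]; last exact: glueK.
  apply: eq_big => [s|s _]; first by rewrite cutK.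
  by apply: eq_bigr => k _; rewrite fprodE.
pose P k := [ffun t => f k t].
transitivity (\sum_(t : blocks) \prod_(k in I) P k (t k)).
  by apply: eq_bigr => t _; apply: eq_bigr => k _; rewrite ffunE.
rewrite big_fprod -[LHS](bigA_distr_big_dep _ (fun k g => untag 0 (P k) g)).
apply: eq_bigr => k _; rewrite -(big_tag (fun (k : I) => (P k : 'S_(part k) -> R))).
by apply: eq_bigr => t _; rewrite ffunE.
Qed.

Lemma card_young : (#|young n lam| = \prod_(k : I) #|[set: 'S_(part k)]|)%N.
Proof.
pose one (k : I) (t : 'S_(part k)) := 1%N.
rewrite -sum1_card (eq_bigr (fun s => (\prod_(k : I) one k (block_perm lam k s))%N)).
  rewrite [LHS](sum_young one); apply: eq_bigr => k _.
  by rewrite -sum1_card; apply: eq_bigl => t; rewrite inE.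
by move=> s _; rewrite big1.
Qed.

End YoungProduct.

Lemma all2_part_size (la : seq nat) mus : all2 is_part la mus -> size la = size mus.
Proof. by rewrite all2E => /andP[/eqP]. Qed.

Lemma all2_part_nth (la : seq nat) mus k : all2 is_part la mus -> (k < size la)%N ->
  is_part (nth 0%N la k) (nth [::] mus k).
Proof.
elim: la mus k => [|l la IHla] [|mu mus] [|k] //= /andP[l_mu] //.
by move/IHla; apply.
Qed.

Section Gamma.

Variables (F : closedFieldType) (n : nat) (lam : intpart n).
Hypothesis F0 : [pchar F] =i pred0.

Local Notation part k := (nth 0%N lam k).
Local Notation specht_of k mu := (specht F (part k) mu).

Lemma mxtrace_tens (gT : finGroupType) (G : {group gT})
    (rs : seq (representation F G)) g :
  \tr (tens_repr rs g) = \prod_(r <- rs) \tr (r g).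
Proof.
elim: rs => [|r rs IHrs] /=; first by rewrite big_nil mxtrace1.
by rewrite big_cons mxtrace_prod IHrs.
Qed.

Lemma rdegree_tens (gT : finGroupType) (G : {group gT})
    (rs : seq (representation F G)) :
  (rdegree (tens_repr rs) = \prod_(r <- rs) rdegree r)%N.
Proof. by elim: rs => [|r rs IHrs] /=; rewrite ?big_nil // big_cons -IHrs. Qed.

Lemma mxtrace_gamma mus s : \tr (gamma F lam mus s) =
  \prod_(k < size lam) \tr (specht_of k (nth [::] mus k) (block_perm lam k s)).
Proof. by rewrite mxtrace_tens big_map -[in LHS](subn0 (size lam)) big_mkord. Qed.

Lemma rdegree_gamma mus : (rdegree (gamma F lam mus) =
  \prod_(k < size lam) rdegree (Representation (specht_of k (nth [::] mus k))))%N.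
Proof. by rewrite rdegree_tens big_map -[in LHS](subn0 (size lam)) big_mkord. Qed.

(** By sum_young the inner product is the product of those of the Specht modules. *)
Lemma cdot_gamma mus nus : all2 is_part lam mus -> all2 is_part lam nus ->
  cdot (gamma F lam mus) (gamma F lam nus) = (mus == nus)%:R.
Proof.
move=> mu_part nu_part; have s_mu := all2_part_size mu_part.
have s_nu := all2_part_size nu_part.
rewrite /cdot card_young natr_prod.
pose f k mu nu (t : 'S_(part k)) :=
  \tr (specht_of k mu t) * \tr (specht_of k nu t^-1%g).
pose g (k : 'I_(size lam)) t := f k (nth [::] mus k) (nth [::] nus k) t.
rewrite (eq_bigr (fun s => \prod_(k < size lam) g k (block_perm lam k s))); last first.
  move=> s ys; rewrite !mxtrace_gamma -big_split /=; apply: eq_bigr => k _.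
  by rewrite /g /f -(morphV (block_perm_morphism lam k)).
rewrite (sum_young g) -prodfV -big_split /=.
rewrite (eq_bigr (fun k : 'I_(size lam) => (nth [::] mus k == nth [::] nus k)%:R)).
  rewrite -natr_prod; congr _%:R; have [<-|ne] := eqVneq mus nus.
    by rewrite big1 // => k _; rewrite eqxx.
  have /existsP[k ne_k] : [exists k : 'I_(size lam), nth [::] mus k != nth [::] nus k].
    apply: contraNT ne; rewrite negb_exists => /forallP eq_k.
    apply/eqP/(eq_from_nth (x0 := [::])); first by rewrite -s_mu.
    by move=> k lt_k; rewrite -s_mu in lt_k; apply/eqP/negPn/(eq_k (Ordinal lt_k)).
  by rewrite (bigD1 k) //= (negPf ne_k) mul0n.
move=> k _.
rewrite -(cdot_specht F0 (all2_part_nth mu_part (ltn_ord k))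
                         (all2_part_nth nu_part (ltn_ord k))) /cdot.
congr (_ * _).
by apply: eq_bigl => t; rewrite inE.
Qed.

End Gamma.

(** * Induced representations *)

Section InducedTrace.

Variables (F : closedFieldType) (gT : finGroupType) (G : {group gT}).
Hypothesis F0 : [pchar F] =i pred0.

Section OneSubgroup.

Variables (H : {group gT}) (sHG : H \subset G).
Variables (d : nat) (rho : mx_representation F H d).

Lemma ext0_mxJ h x : h \in H ->
  \tr (ext0_mx rho (h * x * h^-1)%g) = \tr (ext0_mx rho x).
Proof.
move=> Hh; rewrite /ext0_mx groupMr ?groupV // groupMl //; case: ifP => // Hx.
rewrite !repr_mxM ?groupM ?groupV // mxtrace_mulC mulmxA -repr_mxM ?groupV //.
by rewrite mulVg repr_mx1 mul1mx.
Qed.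

(** Frobenius's formula.  Letting x run over G instead of coset representatives
   repeats each term of the trace for the elements of one coset of H. *)
Lemma mxtrace_ind g : #|H|%:R * \tr (ind_repr sHG rho g) =
  \sum_(x in G) \tr (ext0_mx rho (x * g * x^-1)%g).
Proof.
rewrite /ind_repr /= /ind_mx mxtrace_mxblock mulr_sumr.
rewrite (partition_big (fun x => H :* x)%g (mem (rcosets H G))) => [|x Gx]; last first.
  by rewrite /= mem_rcosets mulSGid.
rewrite [RHS]big_enum_val /=; apply: eq_bigr => i _.
rewrite mulr_natl -(card_rcoset H (coset_rep i)) -sumr_const.
apply: eq_big => [x|x]; rewrite rcoset_coset_rep.
  apply/idP/andP => [ix|[Gx /eqP <-]]; last exact: rcoset_refl.
  have /rcosetsP[y Gy Dy] := enum_valP i; rewrite Dy in ix *.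
  rewrite (rcoset_eqP ix) eqxx; split=> //.
  by have /rcosetP[h /(subsetP sHG) Gh ->] := ix; rewrite groupM.
rewrite -rcoset_coset_rep => /rcosetP[h Hh ->].
by rewrite -[LHS](ext0_mxJ _ Hh) invMg !mulgA.
Qed.

End OneSubgroup.

Variables (H K : {group gT}) (sHG : H \subset G) (sKG : K \subset G).
Variables (d e : nat) (rho : mx_representation F H d) (sigma : mx_representation F K e).

(** Mackey's formula, before grouping y into double cosets.  In the product of two
   induced traces, conjugating g makes the first one contribute #|G| equal terms. *)
Lemma cdot_ind :
  #|H|%:R * #|K|%:R * cdot (ind_repr sHG rho) (ind_repr sKG sigma) =
  \sum_(y in G) \sum_(g in H)
     \tr (rho g) * \tr (ext0_mx sigma (y * g^-1 * y^-1)%g).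
Proof.
rewrite [RHS]exchange_big /= /cdot mulrCA.
apply: (canLR (mulKf _)); first by rewrite natr_neq0.
rewrite mulr_sumr.
pose a g := \sum_(y in G) \tr (ext0_mx sigma (y * g^-1 * y^-1)%g).
transitivity (\sum_(x in G) \sum_(g in G) \tr (ext0_mx rho (x * g * x^-1)%g) * a g).
  rewrite exchange_big; apply: eq_bigr => g Gg.
  by rewrite mulrACA !mxtrace_ind mulr_suml.
have aJ x g : x \in G -> a (x^-1 * g * x)%g = a g.
  move=> Gx; rewrite /a (reindex_inj (mulIg x)) /=.
  apply: eq_big => [y|y _]; first by rewrite groupMr.
  by rewrite !invMg invgK !mulgA !mulgK.
rewrite mulr_natl -sumr_const; apply: eq_bigr => x Gx.
rewrite (reindex_inj (inj_comp (mulIg x) (mulgI x^-1)%g)) /=.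
rewrite (bigID (mem H)) /= [X in _ + X]big1 ?addr0 => [|g /andP[_ nHg]].
  apply: eq_big => [g|g /andP[_ Hg]].
    rewrite groupMr // groupMl ?groupV // andb_idl //; exact: (subsetP sHG).
  by rewrite aJ // !mulgA mulgV mul1g mulgK /ext0_mx Hg mulr_sumr.
by rewrite !mulgA mulgV mul1g mulgK /ext0_mx (negPf nHg) mxtrace0 mul0r.
Qed.

End InducedTrace.

(** * Induced representations of the wreath product *)

Section WreathCharacters.

Variables (F : closedFieldType) (n q : nat) (eps : F).
Hypotheses (F0 : [pchar F] =i pred0) (eps_prim : q.-primitive_root eps).

Local Notation A := (Aq n q).
Local Notation B := (Bq n q).
Local Notation chiA b a := (eps ^+ val (pairing b a)).
Implicit Types (a b : A) (u v y g : B) (s t : 'S_n).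

Let q_gt0 : (0 < q)%N. Proof. exact: prim_order_gt0 eps_prim. Qed.

Lemma pairing_perm b a s :
  pairing b (perm_coord a s) = pairing (perm_coord b s^-1%g) a.
Proof.
rewrite /pairing (reindex_inj (@perm_inj _ s)) /=; apply: eq_bigr => i _.
by rewrite !mxE permK invgK.
Qed.

Lemma chiA0 b : chiA b 0 = 1.
Proof. exact: (@chi1 n q F eps b). Qed.

Lemma chiAN b a : chiA b a * chiA b (- a) = 1.
Proof. by rewrite -(chi_add eps_prim) subrr chiA0. Qed.

Lemma chiA_separates b b' : b != b' -> exists a, chiA b a * chiA b' (- a) != 1.
Proof.
move=> ne_b; have /existsP[i ne_i] : [exists i, b ord0 i != b' ord0 i].
  apply: contraNT ne_b; rewrite negb_exists => /forallP eq_b.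
  by apply/eqP/rowP => i; apply/eqP/negPn.
(* The pairing with this unit vector reads off the coordinate i. *)
pose a : A := \row_j if j == i then inZp 1 else 0.
have pair_a c : pairing c a = c ord0 i.
  rewrite /pairing (bigD1 i) //= big1 ?addr0 => [|j /negPf ne_ji].
    by apply: val_inj; rewrite mxE eqxx /= modnMmr muln1 modn_small.
  by apply: val_inj; rewrite mxE ne_ji /= muln0 mod0n.
exists a; apply: contra ne_i => /eqP E.
have : chiA b a = chiA b' a.
  by rewrite -[LHS]mulr1 -(chiAN b' a) mulrCA E mulr1.
move/eqP; rewrite !pair_a (eq_prim_root_expr eps_prim) => eq_mod.
have lt_q (k : Zmod q) : (val k < q)%N by apply: leq_trans (ltn_ord k) _; rewrite prednK.
by move: eq_mod; rewrite !modn_small // => /val_eqP.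
Qed.

Fact Bq_pair_subproof s a : (s, a) \in setX [set: 'S_n] [set: A].
Proof. by rewrite !inE. Qed.

Definition Bq_pair s a : B :=
  SdPair (perm_coord_groupAction n q) (Bq_pair_subproof s a).

Definition transl a : B := Bq_pair 1%g a.

Lemma Bq_pairK g : Bq_pair g.1 g.2 = g.
Proof. by apply: val_inj; case: g => [[s a] gP]. Qed.

Lemma perm_coord1 a : perm_coord a 1%g = a.
Proof. by apply/rowP => i; rewrite mxE invg1 perm1. Qed.

Lemma Bq_mul1 u v : (u * v)%g.1 = (u.1 * v.1)%g. Proof. by []. Qed.
Lemma Bq_mul2 u v : (u * v)%g.2 = perm_coord u.2 v.1 + v.2. Proof. by []. Qed.
Lemma Bq_inv1 u : (u^-1)%g.1 = (u.1^-1)%g. Proof. by []. Qed.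
Lemma Bq_inv2 u : (u^-1)%g.2 = perm_coord (- u.2) u.1^-1%g. Proof. by []. Qed.

Lemma mem_Dq lam g : (g \in Dq n q lam) = (g.1 \in young n lam).
Proof. by apply/morphpreP/idP => [[] //|yg]; rewrite in_setT. Qed.

Lemma card_Dq lam : #|Dq n q lam| = (#|{: A}| * #|young n lam|)%N.
Proof.
rewrite -cardsT mulnC -cardsX.
pose f (p : 'S_n * A) := Bq_pair p.1 p.2.
rewrite -(card_imset (f := f)) => [|[s a] [t a'] /(congr1 val) //].
apply: eq_card => g; rewrite mem_Dq; apply/idP/imsetP => [Yg|[[s a]]].
  exists (g.1, g.2); last exact/esym/Bq_pairK.
  by rewrite in_setX Yg in_setT.
by case/setXP => Yp _ ->.
Qed.

Section OneFactor.

Variables (lam : intpart n) (b : A).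
Hypothesis stab_b : 'C[b | perm_coord_action n q]%g = young n lam.
Variable mus : seq (seq nat).

Definition chi_gamma :=
  prod_repr (chi_repr eps_prim stab_b) (gamma_hat q F lam mus).

Lemma mxtrace_chi_gamma g :
  \tr (chi_gamma g) = chiA b g.2 * \tr (gamma F lam mus g.1).
Proof. by rewrite /chi_gamma /= mxtrace_prod mxtrace_scalar. Qed.

Lemma mxtrace_transl_l a g : g \in Dq n q lam ->
  \tr (ext0_mx chi_gamma (transl a * g)%g) = chiA b a * \tr (ext0_mx chi_gamma g).
Proof.
move=> Dg; have Da : transl a \in Dq n q lam by rewrite mem_Dq group1.
rewrite /ext0_mx groupM // Dg !mxtrace_chi_gamma Bq_mul1 mul1g mulrA.
congr (_ * _); have := chiM eps_prim stab_b Da Dg.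
exact.
Qed.

Lemma mxtrace_transl_r a g :
  \tr (chi_gamma (g * transl a)%g) = chiA b a * \tr (chi_gamma g).
Proof.
rewrite !mxtrace_chi_gamma Bq_mul1 Bq_mul2 mulg1 perm_coord1.
by rewrite (chi_add eps_prim) (mulrC (chiA b g.2)) mulrA.
Qed.

End OneFactor.

Lemma transl_conj y a :
  (y * transl a * y^-1)%g = transl (perm_coord a y.1^-1%g).
Proof.
rewrite -[LHS]Bq_pairK /transl; congr Bq_pair.
  by rewrite !Bq_mul1 Bq_inv1 mulg1 mulgV.
rewrite !Bq_mul2 Bq_inv2; apply/rowP => i; rewrite !mxE /=.
by rewrite invg1 perm1 addrAC addrN add0r.
Qed.

Lemma transl_inv a : (transl a)^-1%g = transl (- a).
Proof.
rewrite -[LHS]Bq_pairK /transl Bq_inv1 Bq_inv2 /= invg1.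
by rewrite perm_coord1.
Qed.

Section Pairing.

Variables (lam lam' : intpart n) (b b' : A).
Hypothesis stab_b : 'C[b | perm_coord_action n q]%g = young n lam.
Hypothesis stab_b' : 'C[b' | perm_coord_action n q]%g = young n lam'.
Variables mus mus' : seq (seq nat).

Local Notation psi := (chi_gamma stab_b mus).
Local Notation psi' := (chi_gamma stab_b' mus').
Local Notation D := (Dq n q lam).

(** Replacing g by its product with a translation a permutes the terms and multiplies
   the sum by the value at a of the character of A_n(q) that is the quotient of
   those of b and of b' moved by y; some a makes this value different from 1. *)
Lemma sum_transl0 y : perm_coord b' y.1 != b ->
  \sum_(g in D) \tr (psi g) * \tr (ext0_mx psi' (y * g^-1 * y^-1)%g) = 0.
Proof.
rewrite eq_sym => /chiA_separates[a]; set T := \sum_(g in D) _; set w := _ * _ => ne_w.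
suffices : T = w * T.
  move/eqP; rewrite -subr_eq0 -{1}[T]mul1r -mulrBl mulf_eq0 subr_eq0 eq_sym.
  by rewrite (negPf ne_w) => /eqP.
rewrite /T mulr_sumr (reindex_inj (mulIg (transl a))) /=.
apply: eq_big => [g|g Dg]; first by rewrite groupMr // mem_Dq group1.
rewrite mxtrace_transl_r.
have -> : (y * (g * transl a)^-1 * y^-1
    = transl (perm_coord (- a) y.1^-1) * (y * g^-1 * y^-1))%g.
  by rewrite -transl_conj -transl_inv invMg !mulgA !mulgKV.
have [Dw|nDw] := boolP ((y * g^-1 * y^-1)%g \in Dq n q lam'); last first.
  rewrite /ext0_mx groupMl ?(negPf nDw) ?mxtrace0 ?mulr0 //.
  by rewrite mem_Dq group1.
by rewrite mxtrace_transl_l // pairing_perm invgK /w mulrACA.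
Qed.

(** In Mackey's formula every y contributes 0. *)
Lemma cdot_ind_chi_gamma0 : (forall s, perm_coord b' s != b) ->
  cdot (ind_chi_gamma eps_prim stab_b mus) (ind_chi_gamma eps_prim stab_b' mus') = 0.
Proof.
move=> ne_b; have nz (H : {group B}) : #|H|%:R != 0 :> F.
  by rewrite natr_neq0 ?cardG_gt0.
apply: (mulfI (mulf_neq0 (nz D) (nz (Dq n q lam')))).
rewrite mulr0 (cdot_ind F0 (subsetT D) (subsetT (Dq n q lam')) psi psi').
by rewrite big1 // => y _; apply: sum_transl0.
Qed.

End Pairing.

Section SameOrbit.

Variables (lam : intpart n) (b : A).
Hypotheses stab_b stab_b' : 'C[b | perm_coord_action n q]%g = young n lam.
Variables mus mus' : seq (seq nat).

Local Notation psi := (chi_gamma stab_b mus).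
Local Notation psi' := (chi_gamma stab_b' mus').
Local Notation D := (Dq n q lam).

Lemma sum_Dq (f : 'S_n -> F) :
  \sum_(g in D) f g.1 = #|{: A}|%:R * \sum_(s in young n lam) f s.
Proof.
rewrite (reindex (fun p : 'S_n * A => Bq_pair p.1 p.2)) /=; last first.
  exists (fun g : B => (g.1, g.2)) => [[s a] _ //|g _]; exact: Bq_pairK.
rewrite (eq_bigl (fun p => (p.1 \in young n lam) && xpredT p.2)) => [|p]; last first.
  by rewrite andbT mem_Dq.
rewrite -(pair_big (mem (young n lam)) xpredT (fun s _ => f s)) mulr_sumr.
by apply: eq_bigr => s _; rewrite sumr_const mulr_natl.
Qed.

(** In Mackey's formula only the y that fix b contribute.  These are the elements
   of D, so the inner product is that of psi and psi' over D, in which the values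
   of the character of b cancel. *)
Lemma cdot_ind_chi_gamma :
  cdot (ind_chi_gamma eps_prim stab_b mus) (ind_chi_gamma eps_prim stab_b' mus')
  = cdot (gamma F lam mus) (gamma F lam mus').
Proof.
have nzD : #|D|%:R != 0 :> F by apply: natr_neq0 F0 _ (cardG_gt0 _).
apply: (mulfI (mulf_neq0 nzD nzD)).
rewrite (cdot_ind F0 (subsetT D) (subsetT D) psi psi').
pose T y := \sum_(g in D) \tr (psi g) * \tr (ext0_mx psi' (y * g^-1 * y^-1)%g).
rewrite -[LHS]/(\sum_(y in [set: B]) T y) [LHS](bigID (mem D)) /=.
rewrite [X in _ + X]big1 ?addr0 => [|y /andP[_ nDy]]; last first.
  apply: (sum_transl0 stab_b stab_b'); apply/eqP => fix_b; case/negP: nDy.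
  by rewrite mem_Dq -stab_b; apply/astab1P.
transitivity (\sum_(y in D) \sum_(g in D)
    \tr (gamma F lam mus g.1) * \tr (gamma F lam mus' (g.1)^-1%g)).
  apply: eq_big => [y|y /andP[_ Dy]]; first by rewrite inE.
  apply: eq_bigr => g Dg; rewrite ext0_mxJ // /ext0_mx groupV Dg !mxtrace_chi_gamma.
  rewrite mulrACA Bq_inv1; have := chiM eps_prim stab_b Dg (groupVr Dg).
  by rewrite mulgV chi1 /chi => <-; rewrite mul1r.
pose f s := \tr (gamma F lam mus s) * \tr (gamma F lam mus' s^-1%g).
rewrite sumr_const (sum_Dq f).
rewrite /cdot -[LHS]mulr_natl -[RHS]mulrA; congr (_ * _).
by rewrite card_Dq natrM -mulrA mulVKf // natr_neq0 ?cardG_gt0.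
Qed.

End SameOrbit.

End WreathCharacters.

(** * Enumerating the labels *)

Section LabelCount.

Local Open Scope nat_scope.

Fixpoint part_lists (la : seq nat) : seq (seq (seq nat)) :=
  if la is l :: la' then
    [seq (val mu) :: mus | mu <- enum {: intpart l}, mus <- part_lists la']
  else [:: [::]].

Lemma mem_part_lists la mus : (mus \in part_lists la) = all2 is_part la mus.
Proof.
elim: la mus => [|l la IHla] [|mu mus] //=.
  by apply/negbTE/allpairsP => -[[mu mus] [_ _ /=]].
apply/allpairsP/andP => [[[nu nus] /= [_ mem_nus [-> ->]]]|[l_mu la_mus]].
  by rewrite -IHla; split=> //; apply: partsP.
by exists (IntPart l_mu, mus); rewrite mem_enum IHla.
Qed.

Lemma part_lists_uniq la : uniq (part_lists la).
Proof.
elim: la => //= l la IHla; apply: allpairs_uniq; rewrite ?enum_uniq //.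
by move=> [mu mus] [nu nus] _ _ /= [/val_inj-> ->].
Qed.

Lemma sum_part_lists (f : nat -> seq nat -> nat) la :
  \sum_(mus <- part_lists la) \prod_(k < size la) f (nth 0 la k) (nth [::] mus k)
  = \prod_(k < size la) \sum_(mu : intpart (nth 0 la k)) f (nth 0 la k) (val mu).
Proof.
elim: la => [|l la IHla] /=; first by rewrite big_seq1 !big_ord0.
rewrite big_ord_recl /= -IHla big_allpairs_dep big_distrl /= big_enum /=.
apply: eq_bigr => mu _; rewrite big_distrr /=; apply: eq_bigr => mus _.
by rewrite big_ord_recl.
Qed.

Lemma size_part_lists la : size (part_lists la) = \prod_(l <- la) npart l.
Proof.
rewrite (big_nth 0) big_mkord -sum1_size; have := sum_part_lists (fun _ _ => 1) la.
rewrite (eq_bigr (fun=> 1)) => [->|mus _]; last by rewrite big1.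
by apply: eq_bigr => k _; rewrite sum1_card.
Qed.

Variables n q : nat.
Hypothesis q_gt0 : 0 < q.

Lemma label_eq (x y : label n q) :
  (lab_orbit x, lab_mus x) = (lab_orbit y, lab_mus y) -> x = y.
Proof.
case: x y => [la O mus la_le fibO musP] [la' O' mus' la'_le fibO' musP'] /= [eqO eq_mus].
rewrite -{}eqO in fibO' *; rewrite -{}eq_mus in musP' *.
have eq_la : la = la'.
  move: (fibO) (fibO'); rewrite !inE => /andP[_ /eqP <-] /andP[_ /eqP <-] //.
rewrite -{}eq_la in la'_le fibO' musP' *.
by congr Label; apply: bool_irrelevance.
Qed.

Lemma part_le_orbit (O : {set Aq n q}) : orbit_type O \in part_le n q.
Proof.
rewrite inE /= size_sort size_filter (leq_trans (count_size _ _)) //.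
by rewrite size_image card_ord prednK.
Qed.

(** A label is determined by its orbit and its list of partitions; the statement
   about sums lets the label type be summed over without a finType structure. *)
Lemma label_enum : exists k (lab : 'I_k -> label n q),
  [/\ injective lab, forall x, exists i, lab i = x
    & forall f : {set Aq n q} -> seq (seq nat) -> nat,
      \sum_i f (lab_orbit (lab i)) (lab_mus (lab i))
      = \sum_(O in orbits n q) \sum_(mus <- part_lists (orbit_type O)) f O mus].
Proof.
pose L := [seq (C, mus) | C <- enum (orbits n q), mus <- part_lists (orbit_type C)].
have L_uniq : uniq L.
  apply: allpairs_uniq_dep => [|C _|]; rewrite ?enum_uniq ?part_lists_uniq //.
  by move=> [O mus] [O' mus'] _ _ /= [-> ->].
have lab_ex (i : 'I_(size L)) : exists x : label n q,
    (lab_orbit x, lab_mus x) = nth (set0, [::]) L i.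
  have /allpairsPdep[O [mus [memO mem_mus ->]]] := mem_nth (set0, [::]) (ltn_ord i).
  have fibO : O \in orbit_fiber q (orbit_type O).
    by rewrite inE eqxx andbT -mem_enum.
  rewrite mem_part_lists in mem_mus.
  by exists (Label (part_le_orbit O) fibO mem_mus).
have [lab labE] := fin_all_exists lab_ex.
exists (size L), lab; split=> [i j eq_ij|x|f].
- apply/val_inj/eqP; rewrite -(nth_uniq (set0, [::]) _ _ L_uniq) ?ltn_ord //.
  by rewrite -!labE eq_ij.
- have memx : (lab_orbit x, lab_mus x) \in L.
    have := lab_orbitP x; rewrite inE => /andP[orbO /eqP typeO].
    apply/allpairsPdep; exists (lab_orbit x), (lab_mus x).
    by rewrite mem_enum mem_part_lists typeO lab_musP.
  have lt_x : index (lab_orbit x, lab_mus x) L < size L by rewrite index_mem.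
  exists (Ordinal lt_x); have := labE (Ordinal lt_x); rewrite nth_index //.
  exact: label_eq.
rewrite [LHS](eq_bigr (fun i : 'I_(size L) => uncurry f (nth (set0, [::]) L i))).
  transitivity (\sum_(p <- L) uncurry f p).
    by rewrite (big_nth (set0, [::])) big_mkord.
  by rewrite big_allpairs_dep big_enum.
by move=> i _; rewrite -labE.
Qed.

End LabelCount.

(** * Orbits and monomials *)

Section OrbitCount.

Local Open Scope nat_scope.

Variables n q : nat.
Hypothesis q_gt0 : 0 < q.
Local Notation A := (Aq n q).
Implicit Types b c : A.

Local Notation orb b := (orbit (perm_coord_action n q) [set: 'S_n] b).

Lemma mult_perm b (s : 'S_n) k : mult (perm_coord b s) k = mult b k.
Proof.
rewrite /mult -[RHS](card_preimset _ (@perm_inj _ s^-1%g)).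
by apply: eq_card => i; rewrite !inE mxE.
Qed.

Lemma count_mult b k : count_mem k [seq b ord0 i | i <- enum 'I_n] = mult b k.
Proof.
rewrite /mult count_map cardE -size_filter /enum_mem -!enumT -filter_predI.
by congr size; apply: eq_filter => i; rewrite /= ?inE ?andbT.
Qed.

(** The coordinates of b and c are then the same up to a permutation. *)
Lemma mult_orbit b c : mult b =1 mult c -> c \in orb b.
Proof.
move=> eq_m; have /tuple_permP[s Ds] :
    perm_eq [tuple c ord0 i | i < n] [tuple b ord0 i | i < n].
  by apply/allP => k _; rewrite /= !count_mult eq_m.
apply/orbitP; exists s^-1%g; rewrite ?inE //; apply/rowP => i; rewrite mxE invgK.
have := congr1 (fun t => nth 0%R t i) Ds.
by rewrite -!tnth_nth !tnth_mktuple => ->.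
Qed.

Lemma sum_card_orbits : \sum_(O in orbits n q) #|O| = #|{: A}|.
Proof.
have acts_A : [acts [set: 'S_n], on [set: A] | perm_coord_action n q]%g.
  by apply/actsP => s _ b; rewrite !inE.
have /card_partition := orbit_partition acts_A; rewrite cardsT => ->.
apply: eq_bigl => O; apply/imsetP/imsetP => [[b _ ->]|[b _ ->]]; by exists b.
Qed.

Lemma orbitE O b : O \in orbits n q -> b \in O -> O = orb b.
Proof. by case/imsetP => c _ -> /orbit_eqP. Qed.

Lemma mem_repr_orbit O : O \in orbits n q -> repr O \in O.
Proof. by case/imsetP => c _ ->; apply: mem_repr (orbit_refl _ _ _). Qed.

Lemma card_orbit_young (r : orbit_reps n q) O : O \in orbits n q ->
  #|O| * #|young n (orbit_type O)| = #|[set: 'S_n]|.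
Proof.
move=> orbO; rewrite -(orep_stab r orbO) {1}(orbitE orbO (orep_in r orbO)).
by rewrite card_orbit mulnC setTI (Lagrange (subsetT _)).
Qed.

Section Exponents.

Variable N : nat.
Hypothesis le_qN : q <= N.

(** The multiplicities of the residues in b, as the exponents of a monomial in N
   variables; those from q on are padding. *)
Definition exponent b (i : nat) : nat := if i < q then mult b (inord i) else 0.

Lemma codom_exponent b :
  [seq k <- [seq exponent b (val i) | i : 'I_N] | k != 0]
  = [seq l <- [seq mult b k | k : Zmod q] | l != 0].
Proof.
have -> : [seq exponent b (val i) | i : 'I_N] = map (exponent b) (iota 0 N).
  by rewrite -val_enum_ord -map_comp.
rewrite -(subnKC le_qN) iotaD map_cat filter_cat [X in _ ++ X]/= -[RHS]cats0.
congr (_ ++ _).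
  congr filter; have -> : iota 0 q = map val (enum 'I_q.-1.+1).
    by rewrite val_enum_ord prednK.
  rewrite -map_comp; apply: eq_map => k /=.
  by rewrite /exponent -[X in _ < X](prednK q_gt0) ltn_ord inord_val.
apply/eqP; rewrite -(negbK (_ == _)) -has_filter; apply/hasPn => l /mapP[j].
by rewrite mem_iota add0n => /andP[ge_j _] ->; rewrite /exponent ltnNge ge_j.
Qed.

Lemma sum_exponent b : \sum_(i < N) exponent b i = n.
Proof.
transitivity (sumn [seq k <- [seq exponent b (val i) | i : 'I_N] | k != 0]).
  rewrite sumnE big_filter [RHS]big_mkcond big_map big_enum /=.
  by apply: eq_bigr => i _; case: eqP.
rewrite codom_exponent -[RHS](sumn_parts (lam_of b)) /= /orbit_type_seq.
by rewrite (perm_sumn (permEl (perm_sort _ _))).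
Qed.

Lemma exists_exponent (a : 'I_N -> nat) : \sum_i a i = n ->
  (forall i : 'I_N, q <= i -> a i = 0) -> exists b, forall i : 'I_N, exponent b i = a i.
Proof.
move=> sum_a supp_a.
have le_N : q.-1.+1 <= N by rewrite prednK.
pose m (k : Zmod q) := a (widen_ord le_N k).
pose c := flatten [seq nseq (m k) k | k <- enum 'I_q.-1.+1].
have count_c k : count_mem k c = m k.
  rewrite /c count_flatten -map_comp sumnE big_map big_enum /=.
  rewrite (bigD1 k) //= count_nseq /= eqxx mul1n big1 ?addn0 // => l /negPf ne_lk.
  by rewrite count_nseq /= ne_lk mul0n.
have size_c : size c == n.
  rewrite size_flatten /shape -map_comp sumnE big_map big_enum /= -sum_a.
  rewrite (eq_bigr m) => [|k _]; last by rewrite /= size_nseq.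
  apply/eqP; rewrite [RHS](bigID (fun i : 'I_N => i < q)) /= [X in _ + X]big1.
    rewrite addn0 /m -(big_ord_narrow le_N); apply: eq_bigl => i.
    by rewrite prednK.
  by move=> i; rewrite -leqNgt => /supp_a.
pose b : A := \row_i tnth (Tuple size_c) i.
have mult_b k : mult b k = m k.
  rewrite -count_c -count_mult /=; congr count.
  rewrite -[RHS]/(val (Tuple size_c)) -[RHS]map_tnth_enum.
  by apply: eq_map => i; rewrite mxE.
exists b => i; rewrite /exponent; case: ltnP => [lt_i|/supp_a //].
rewrite mult_b /m; congr a; apply: val_inj; rewrite /= inordK //.
by rewrite prednK.
Qed.

End Exponents.

Section MonomialValue.

Variables (N : nat) (lam : intpart n).
Hypothesis le_qN : q <= N.

Definition orbit_exponent (O : {set A}) : 'X_{1..N < (sumn lam).+1} :=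
  insubd bm0 [multinom exponent (repr O) i | i < N].

Lemma orbit_exponentE O i : orbit_exponent O i = exponent (repr O) i.
Proof.
rewrite /orbit_exponent insubdK ?mnmE // unfold_in mdegE.
by rewrite (eq_bigr _ (fun i _ => mnmE _ i)) sum_exponent // sumn_parts.
Qed.

Definition exponent_of_type (a : 'X_{1..N < (sumn lam).+1}) :=
  perm_eq [seq k <- codom (fun i : 'I_N => a i) | k != 0] lam
  && [forall i : 'I_N, (q <= i) ==> (a i == 0)].

Lemma exponent_repr O b i : O \in orbits n q -> b \in O ->
  exponent (repr O) i = exponent b i.
Proof.
move=> orbO bO; rewrite /exponent; case: ifP => // _.
have := mem_repr_orbit orbO; rewrite (orbitE orbO bO) => /orbitP[s _ <-].
exact: mult_perm.
Qed.

Lemma orbit_exponent_inj : {in orbits n q &, injective orbit_exponent}.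
Proof.
move=> O O' orbO orbO' eq_a.
have eq_m : mult (repr O) =1 mult (repr O').
  move=> k; have lt_q : k < q by apply: leq_trans (ltn_ord k) _; rewrite prednK.
  have := congr1 (fun a : 'X_{1..N < (sumn lam).+1} =>
                    a (Ordinal (leq_trans lt_q le_qN))) eq_a.
  by rewrite /= !orbit_exponentE /exponent /= lt_q inord_val.
rewrite (orbitE orbO (mem_repr_orbit orbO)).
by rewrite (orbitE orbO' (mem_repr_orbit orbO')); apply/esym/orbit_eqP/mult_orbit.
Qed.

(** An orbit is determined by the multiplicities of the residues, which can be any
   numbers with sum n, so orbits correspond to monomials. *)
Lemma card_exponent_of_type :
  #|[pred a | exponent_of_type a]| = #|orbit_fiber q lam|.
Proof.
rewrite -(card_in_imset (f := orbit_exponent)) => [|O O']; last first.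
  by rewrite !inE => /andP[orbO _] /andP[orbO' _]; apply: orbit_exponent_inj.
apply: eq_card => a; rewrite inE /=; apply/andP/imsetP => [[perm_a /forallP supp_a]|].
  have sum_a : \sum_i a i = n.
    apply: etrans (sumn_parts lam); apply: etrans (perm_sumn perm_a).
    rewrite [RHS]sumnE big_filter [RHS]big_mkcond big_map big_enum.
    by apply: eq_bigr => i _; case: eqP.
  have [b bE] := exists_exponent le_qN sum_a
                   (fun i le_i => eqP (implyP (supp_a i) le_i)).
  have orbO : orb b \in orbits n q by apply/imsetP; exists b.
  exists (orb b).
    rewrite inE orbO orbit_typeE; apply/eqP/val_inj => /=.
    have geq_anti : antisymmetric geq.
      by move=> x y /= /andP[le1 le2]; apply/eqP; rewrite eqn_leq le2.
    apply: (sorted_eq geq_trans geq_anti).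
      exact: (sort_sorted (fun x y => leq_total y x)).
    by case/and3P: (partsP lam).
    rewrite perm_sort -(codom_exponent le_qN); apply: perm_trans perm_a.
    suffices -> : [seq exponent b (val i) | i : 'I_N]
        = codom (fun i : 'I_N => a i) by [].
    exact: eq_map bE _.
  apply/val_inj/mnmP => i /=.
  by rewrite orbit_exponentE (exponent_repr i orbO (orbit_refl _ _ _)) bE.
case=> O; rewrite inE => /andP[orbO /eqP type_O] ->; split.
  rewrite (eq_codom (orbit_exponentE O)) /codom codom_exponent //.
  by rewrite -(congr1 (@parts n) type_O) /= /orbit_type_seq perm_sym perm_sort.
apply/forallP => i; apply/implyP => le_i.
by rewrite orbit_exponentE /exponent ltnNge le_i.
Qed.

(** A monomial takes the value 1 or 0, according to whether its variables are all
   among the first q; the former are counted by card_exponent_of_type. *)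
Lemma meval_mon_sym :
  ((mon_sym N lam).@[fun i : 'I_N => (i < q)%:R] = #|orbit_fiber q lam|%:R :> int)%R.
Proof.
rewrite /mon_sym raddf_sum /= -card_exponent_of_type -[RHS]sumr_const.
rewrite [LHS]big_mkcond [RHS]big_mkcond; apply: eq_bigr => a _.
rewrite unfold_in /exponent_of_type; case: ifP => //= perm_a.
rewrite mevalX; have [/forallP supp_a|] :=
  boolP [forall i : 'I_N, (q <= i) ==> (a i == 0)].
  rewrite big1 // => i _; have := supp_a i; case: ltnP => [_ _|_ /eqP ->].
    by rewrite expr1n.
  by rewrite expr0.
rewrite negb_forall => /existsP[j]; rewrite negb_imply => /andP[le_j nz_a].
by rewrite (bigD1 j) //= ltnNge le_j expr0n (negPf nz_a) mul0r.
Qed.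

End MonomialValue.

End OrbitCount.

(** * The classification *)

Section Classification.

Variables (F : closedFieldType) (n q : nat) (eps : F).
Hypotheses (F0 : [pchar F] =i pred0) (eps_prim : q.-primitive_root eps).
Variable r : orbit_reps n q.

Local Notation G := [set: Bq n q]%G.
Local Notation V x := (ind_chi_gamma eps_prim (lab_stab r x) (lab_mus x)).
Implicit Types x y : label n q.

Let q_gt0 : (0 < q)%N. Proof. exact: prim_order_gt0 eps_prim. Qed.

Lemma lab_orbitK x : lab_orbit x \in orbits n q /\ orbit_type (lab_orbit x) = lab_lam x.
Proof. by have := lab_orbitP x; rewrite inE => /andP[-> /eqP]. Qed.

Lemma cdot_label x y :
  cdot (V x) (V y) = ((lab_orbit x, lab_mus x) == (lab_orbit y, lab_mus y))%:R.
Proof.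
rewrite xpair_eqE; have [eqO|neO] := eqVneq (lab_orbit x) (lab_orbit y); last first.
  apply: (cdot_ind_chi_gamma0 F0) => s; apply: contra neO => /eqP Ds.
  have [[orbX _] [orbY _]] := (lab_orbitK x, lab_orbitK y).
  rewrite (orbitE orbX (orep_in r orbX)) (orbitE orbY (orep_in r orbY)) -Ds.
  by apply/eqP/orbit_eqP/orbitP; exists s; rewrite ?inE.
rewrite -(cdot_gamma F0 (lab_musP x)); last first.
  by rewrite -(lab_orbitK x).2 eqO (lab_orbitK y).2 lab_musP.
have eq_lam : lab_lam y = lab_lam x by rewrite -(lab_orbitK x).2 eqO (lab_orbitK y).2.
move: (lab_stab r x) (lab_stab r y); rewrite -eqO eq_lam => stab_x stab_y.
exact: cdot_ind_chi_gamma.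
Qed.

Lemma label_irr x : mx_irreducible (V x).
Proof. by apply: (irr_cdot1 F0); rewrite cdot_label eqxx. Qed.

Lemma label_inj x y : mx_rsim (V x) (V y) -> x = y.
Proof.
move=> sim; apply: label_eq; apply/eqP; apply: contraT => ne_xy.
have := cdot_rsim (V x) sim; rewrite !cdot_label eqxx (negPf ne_xy).
by move/eqP; rewrite oner_eq0.
Qed.

Let spd l (mu : seq nat) := rdegree (Representation (specht F l mu)).

Lemma card_Bq : #|G| = (#|{: Aq n q}| * #|[set: 'S_n]|)%N.
Proof.
rewrite -cardsT mulnC -cardsX; pose f (p : 'S_n * Aq n q) := Bq_pair p.1 p.2.
rewrite -(card_imset (f := f)) => [|[s a] [t a'] /(congr1 val) //].
apply: eq_card => g; rewrite inE; apply/esym/imsetP; exists (g.1, g.2); last exact/esym/Bq_pairK.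
by rewrite in_setX !in_setT.
Qed.

(** The first factor is the index of D in G, which is also that of the Young
   subgroup in the symmetric group, the stabilizer of a point of the orbit. *)
Lemma label_degree x : rdegree (Representation (V x)) =
  (#|lab_orbit x| * \prod_(k < size (orbit_type (lab_orbit x)))
     spd (nth 0%N (orbit_type (lab_orbit x)) k) (nth [::] (lab_mus x) k))%N.
Proof.
have [orbO typeO] := lab_orbitK x.
rewrite [LHS]/= sum_nat_const card_ord mul1n rdegree_gamma typeO; congr (_ * _)%N.
apply/eqP; rewrite -(eqn_pmul2r (cardG_gt0 (Dq n q (lab_lam x)))) mulnC.
rewrite (Lagrange (subsetT _)) card_Bq card_Dq mulnCA -typeO.
by rewrite card_orbit_young.
Qed.

(** The squared degrees of the outer tensor products add up to the order of the
   Young subgroup, which is #|[set: 'S_n]| divided by #|O|. *)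
Lemma sum_orbit_degree O : O \in orbits n q ->
  (\sum_(mus <- part_lists (orbit_type O))
     (#|O| * \prod_(k < size (orbit_type O))
        spd (nth 0 (orbit_type O) k) (nth [::] mus k)) ^ 2
   = #|O| * #|[set: 'S_n]|)%N.
Proof.
move=> orbO; rewrite -(card_orbit_young r orbO) card_young mulnA.
pose sqd l mu := (spd l mu ^ 2)%N.
rewrite (eq_bigr (fun mus => #|O| ^ 2 * \prod_(k < size (orbit_type O))
    sqd (nth 0 (orbit_type O) k) (nth [::] mus k))%N) => [|mus _]; last first.
  rewrite expnMn; congr (_ * _)%N; rewrite -mulnn -big_split /=.
  by apply: eq_bigr => k _; rewrite mulnn.
rewrite -big_distrr /= sum_part_lists; congr (_ * _)%N.
by apply: eq_bigr => k _; apply: sum_specht_degree.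
Qed.

(** Adding up sum_orbit_degree over the orbits gives #|A_n(q)| #|S_n| = #|B_n(q)|. *)
Lemma label_complete d (rho : mx_representation F G d) :
  mx_irreducible rho -> exists x, mx_rsim rho (V x).
Proof.
have [k [lab [lab_inj lab_onto sum_lab]]] := label_enum n q_gt0.
pose rs i := Representation (V (lab i)).
have irr_rs i : mx_irreducible (rs i) by apply: label_irr.
have rs_inj i j : mx_rsim (rs i) (rs j) -> i = j by move/label_inj/lab_inj.
have deg_rs : (#|G| <= \sum_i rdegree (rs i) ^ 2)%N.
  rewrite (eq_bigr _ (fun i _ => congr1 (expn^~ 2)%N (label_degree (lab i)))).
  rewrite (sum_lab (fun C mus => (#|C| * \prod_(k < size (orbit_type C))
     spd (nth 0 (orbit_type C) k) (nth [::] mus k)) ^ 2)%N).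
  by rewrite (eq_bigr _ sum_orbit_degree) -big_distrl /= sum_card_orbits card_Bq.
move=> /(irr_family_complete F0 irr_rs rs_inj deg_rs)[i0 sim].
by exists (lab i0).
Qed.

Lemma label_count N : (q <= N)%N -> exists2 k, has_irr_count F G k
  & k%:Z = \sum_(lam : intpart n) (\prod_(l <- lam) npart l)%:Z
                   * (mon_sym N lam).@[fun i : 'I_N => (i < q)%N%:R].
Proof.
move=> le_qN; have [k [lab [lab_inj lab_onto sum_lab]]] := label_enum n q_gt0.
exists k.
  exists (fun i => Representation (V (lab i))); split=> [i|i j /label_inj /lab_inj //|].
    exact: label_irr.
  by move=> d rho /label_complete[x sim]; have [i Di] := lab_onto x; exists i; rewrite Di.
transitivity (\sum_(O in orbits n q) \prod_(l <- orbit_type O) npart l)%N%:Z.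
  congr Posz; rewrite -[LHS](card_ord k) -sum1_card (sum_lab (fun _ _ => 1%N)).
  by apply: eq_bigr => O _; rewrite sum1_size size_part_lists.
rewrite (partition_big (@orbit_type n q) xpredT) //= -natz natr_sum.
apply: eq_bigr => lam _; rewrite meval_mon_sym // natz.
rewrite (eq_bigr (fun=> \prod_(l <- lam) npart l)%N) => [|O /andP[_ /eqP <-] //].
rewrite sum_nat_const mulnC PoszM natz; congr (_ * Posz _).
by apply: eq_card => O; rewrite !inE.
Qed.

End Classification.

Theorem theorem1 (R : realType) (n q : nat) (hn : (0 < n)%N) (hq : odd q)
    (eps : R[i]) (heps : q.-primitive_root eps) (r : orbit_reps n q) :
  let V (x : label n q) :=
    ind_chi_gamma heps (lab_stab r x) (lab_mus x) in
  [/\ forall x : label n q, mx_irreducible (V x),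
      forall x y : label n q, mx_rsim (V x) (V y) -> x = y,
      forall (d : nat) (rho : mx_representation R[i] [set: Bq n q] d),
        mx_irreducible rho -> exists x : label n q, mx_rsim rho (V x)
    & forall N : nat, (q <= N)%N ->
      exists2 k : nat, has_irr_count R[i] [set: Bq n q] k
        & k%:Z = \sum_(lam : intpart n)
                   (\prod_(l <- lam) npart l)%:Z
                   * (mon_sym N lam).@[fun i : 'I_N => (i < q)%N%:R]].
Proof.
move=> V; have F0 : [pchar R[i]] =i pred0 by apply: Num.Theory.pchar_num.
split.
- exact: label_irr F0 heps r.
- exact: label_inj F0 heps r.
- exact: label_complete F0 heps r.
- exact: label_count F0 heps r.
Qed.
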